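(* Let $\mathcal{H}$ be a separable Hilbert space, $\mathcal{L}_0\subset\mathcal{H}$ a closed subspace, $P_0$ the orthogonal projection onto $\mathcal{L}_0$, and $U$ a unitary operator on $\mathcal{H}$. Let $X$ be the operator of the Halmos decomposition of the pair of projections $P=P_0$, $Q=UP_0U^*$. The following are equivalent: (1) $P_0U|_{\mathcal{L}_0}:\mathcal{L}_0\to\mathcal{L}_0$ is Schmidt decomposable. (2) $[P_0,UP_0U^*]=P_0UP_0U^*-UP_0U^*P_0$ is diagonalizable. (3) $X$ is diagonalizable.
   Context: An operator is diagonalizable if there is an orthonormal basis of the space consisting of its eigenvectors. A bounded operator $T$ is Schmidt decomposable if it has a singular value decomposition: there exist (finite or countable) orthonormal systems $\{f_n\}_{n\ge1}$, $\{g_n\}_{n\ge1}$ and positive numbers $s_n$ such that $T=\sum_{n\ge1}s_n\,f_n\otimes g_n$ (strong convergence), where $(f\otimes g)(h)=\langle h,g\rangle f$. Halmos decomposition: given orthogonal projections $P,Q$, put $\mathcal{H}_{11}=R(P)\cap R(Q)$, $\mathcal{H}_{00}=N(P)\cap N(Q)$, $\mathcal{H}_{10}=R(P)\cap N(Q)$, $\mathcal{H}_{01}=N(P)\cap R(Q)$, and let the generic part be $\mathcal{H}'=(\mathcal{H}_{11}\oplus\mathcal{H}_{00}\oplus\mathcal{H}_{10}\oplus\mathcal{H}_{01})^\perp$ ($R$ denotes range and $N$ nullspace). These five subspaces reduce $P$ and $Q$. By a theorem of Halmos there are a Hilbert space $\mathcal{L}$ and a unitary isomorphism $\mathcal{H}'\simeq\mathcal{L}\times\mathcal{L}$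 under which the reductions of $P$ and $Q$ to $\mathcal{H}'$ become $$P'=\begin{pmatrix}1&0\\0&0\end{pmatrix},\qquad Q'=\begin{pmatrix}C^2&CS\\ CS&S^2\end{pmatrix},$$ where $C=\cos(X)\ge0$, $S=\sin(X)\ge0$ for a selfadjoint operator $X$ on $\mathcal{L}$ with $0\le X\le\pi/2$, and $C,S,X$ have trivial nullspaces. *)

(* Defs.v *)
From HB Require Import structures.
From mathcomp Require Import all_boot all_order all_algebra.
From mathcomp Require Import complex.
From mathcomp Require Import all_classical all_reals all_analysis.
Set Implicit Arguments.
Unset Strict Implicit.
Unset Printing Implicit Defensive.
Import Order.TTheory GRing.Theory Num.Theory.
Import numFieldNormedType.Exports.

Local Open Scope classical_set_scope.
Local Open Scope complex_scope.
Local Open Scope ring_scope.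

(* Complex Hilbert spaces: complete normed spaces over R[i] whose norm comes
   from a positive definite hermitian form, linear in its first argument. *)
HB.mixin Record CompleteNormedModule_isHilbert (R : realType) (H : Type)
    & CompleteNormedModule R[i] H := {
  hinner : {dot H for @Num.conj R[i]};
  normr_hinner : forall x : H, `|x| ^+ 2 = hinner x x
}.

#[short(type="hilbertType")]
HB.structure Definition Hilbert (R : realType) :=
  {H of CompleteNormedModule R[i] H & CompleteNormedModule_isHilbert R H}.

Definition inner (R : realType) (H : hilbertType R) (x y : H) : R[i] :=
  @hinner R H x y.

Notation "'<< x , y >>" := (inner x y)
  (at level 0, x at level 99, y at level 99, format "''<<' x ,  y '>>'").

Section Hilbert_spaces.
Context {R : realType} {H : hilbertType R}.
Implicit Types (M B : set H) (P Q S T : H -> H).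

Definition separable_space := exists2 D : set H, countable D & dense D.

Definition closed_subspace M := submod_closed (mem M) /\ closed M.

Definition orthocomp B : set H := [set x | forall y, B y -> '<<x, y>> = 0].

Definition lin_span B : set H :=
  [set x | exists n (c : 'I_n -> R[i]) (v : 'I_n -> H),
     (forall i, B (v i)) /\ x = \sum_(i < n) c i *: v i].

Definition orthonormal_system (J : eqType) (I : set J) (e : J -> H) :=
  forall i j, I i -> I j -> '<<e i, e j>> = (i == j)%:R.

Definition orthonormal_basis M B :=
  [/\ B `<=` M, orthonormal_system B id & closure (lin_span B) = M].

Definition adjoint_pair S T := forall x y, '<<S x, y>> = '<<x, T y>>.

Definition selfadjoint T := adjoint_pair T T.

(* [V] is the adjoint of [U], and U^* U = U U^* = 1. *)
Definition unitary_with_adjoint (U V : H -> H) :=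
  [/\ adjoint_pair U V, cancel U V & cancel V U].

(* In the order of R[i], a <= b forces b - a to be real. *)
Definition op_le S T := forall h, '<<S h, h>> <= '<<T h, h>>.

Definition trivial_nullspace T := forall h, T h = 0 -> h = 0.

Definition orthogonal_projection M P :=
  forall h, M (P h) /\ orthocomp M (h - P h).

Definition commutator P Q : H -> H := fun h => P (Q h) - Q (P h).

(* [diagonalizable_on M T] and [schmidt_decomposable_on M T] concern the
   restriction of [T] to a closed subspace [M] that [T] maps to itself, seen as
   an operator on the Hilbert space [M]; M = setT is the whole space. *)
Definition diagonalizable_on M T :=
  exists2 B, orthonormal_basis M B &
    forall e, B e -> exists a : R[i], T e = a *: e.

Definition rank_one (f g : H) : H -> H := fun h => '<<h, g>> *: f.

(* [Some k] is the range 0, ..., k - 1 and [None] the range of all naturals. *)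
Definition in_range (N : option nat) (n : nat) : bool :=
  if N is Some k then (n < k)%N else true.

Definition schmidt_decomposable_on M T :=
  exists (N : option nat) (f g : nat -> H) (s : nat -> R),
    [/\ forall n, in_range N n -> [/\ M (f n), M (g n) & 0 < s n],
        orthonormal_system [set n | in_range N n] f,
        orthonormal_system [set n | in_range N n] g &
        forall h, M h ->
          (fun m => \sum_(0 <= n < m | in_range N n)
                      (s n)%:C *: rank_one (f n) (g n) h) @ \oo --> T h].

(* cos T and sin T by their power series, for bounded [T]. *)
Definition op_cos T : H -> H := fun h =>
  limn (series (fun n => ((-1) ^+ n / n.*2`!%:R : R[i]) *: iter n.*2 T h)).

Definition op_sin T : H -> H := fun h =>
  limn (series (fun n => ((-1) ^+ n / n.*2.+1`!%:R : R[i])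
                           *: iter n.*2.+1 T h)).

Definition nullspace P : set H := P @^-1` [set 0].

Definition generic_part P Q : set H :=
  let H11 := range P `&` range Q in
  let H00 := nullspace P `&` nullspace Q in
  let H10 := range P `&` nullspace Q in
  let H01 := nullspace P `&` range Q in
  orthocomp [set x | exists h11 h00 h10 h01,
    [/\ H11 h11, H00 h00, H10 h10, H01 h01 & x = h11 + h00 + h10 + h01]].

End Hilbert_spaces.

Arguments separable_space {R} H.

(* [W] is the unitary isomorphism from L x L onto the generic part of the pair
   (P, Q); the product carries the inner product (a,b),(c,d) |-> <a,c> + <b,d>.
   The last two fields are the block matrices of the reductions of P and Q. *)
Record halmos_decomposition (R : realType) (H : hilbertType R) (P Q : H -> H)
    (L : hilbertType R) (W : {linear (L * L)%type -> H}) (X : {linear L -> L})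
    : Prop := {
  halmos_isometry : forall a b c d : L,
    '<<W (a, b), W (c, d)>> = '<<a, c>> + '<<b, d>>;
  halmos_onto : range W = generic_part P Q;
  halmos_selfadjoint : selfadjoint X;
  halmos_X_ge0 : op_le (fun=> 0) X;
  halmos_X_le : op_le X (fun h => (pi / 2)%:C *: h);
  halmos_cos_ge0 : op_le (fun=> 0) (op_cos X);
  halmos_sin_ge0 : op_le (fun=> 0) (op_sin X);
  halmos_X_inj : trivial_nullspace X;
  halmos_cos_inj : trivial_nullspace (op_cos X);
  halmos_sin_inj : trivial_nullspace (op_sin X);
  halmos_P : forall a b : L, P (W (a, b)) = W (a, 0);
  halmos_Q : let C := op_cos X in let S := op_sin X in
    forall a b : L,
    Q (W (a, b)) = W (C (C a) + C (S b), C (S a) + S (S b))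
}.

(* Main.v *)
Require Import Defs.
From HB Require Import structures.
From mathcomp Require Import all_boot all_order all_algebra.
From mathcomp Require Import complex.
From mathcomp Require Import all_classical all_reals all_analysis.
From mathcomp Require Import ring lra.
Import Order.TTheory GRing.Theory Num.Theory.
Import numFieldNormedType.Exports.

Local Open Scope classical_set_scope.
Local Open Scope complex_scope.
Local Open Scope ring_scope.

(** Write [P] for [P0], [Q] for [U P0 U^*], [C] and [S] for the cosine and the
    sine of [X], and [T] for [P0 U] on [L0].  Then [T T^*] is [P Q] on [L0], and
    in the coordinates of the generic part [P Q] acts on the range of [P] as
    [C^2], while the commutator [[P, Q]] sends [(x, y)] to [(C S y, - C S x)].
    On each of the four other summands [P Q] is 0 or 1 and the commutator is 0.
    So each of the three conditions says that [C^2] has enough eigenvectors.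

    This is made precise with the predicate [total_eigenvectors]: only zero is
    orthogonal to all eigenvectors.  By Zorn's lemma and the projection theorem
    a symmetric operator with this property has an orthonormal eigenbasis
    ([total_diagonalizable]); hence it is enough to move eigenvectors around.

    - If [T] is Schmidt decomposable, its left singular vectors are eigenvectors
      of [P Q], and their components in the generic part are eigenvectors of
      [C^2].  A vector [a] orthogonal to all eigenvectors of [C^2] thus makes
      [(a, 0)] orthogonal to the range of [T], so [C a = 0] and [a = 0].  An
      eigenvector [e] of [C^2] is one of [C] and of [S], since these are
      nonnegative and [C^2 + S^2 = 1], and then [(e, i e)] and [(e, - i e)] are
      eigenvectors of the commutator ([total_commutator]).
    - If the commutator is diagonalizable, its square on the generic part, which
      is [C^4 - C^2] on both coordinates, has enough eigenvectors.  As it is a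
      quadratic polynomial in [C^2], they are sums of eigenvectors of [C^2],
      hence of [C] ([commutator_total]).
    - If [X] is diagonalizable then so is [C^2], and hence [T T^*]; its
      eigenvectors for nonzero eigenvalues and their normalised images under
      [T^*] are the singular vectors of [T], countably many by separability
      ([diagonalizable_schmidt]).

    The remaining point is that every eigenvector of [C] is one of [X]
    ([op_cos_eigenvector]).  An eigenspace of [C] is invariant under [X].  Both
    ends of the numerical range of [X] on it are approximate eigenvalues, which
    the cosine maps to the eigenvalue of [C]; as the cosine is injective on
    [[0, pi / 2]] the two ends agree, and [X] is a scalar there. *)

Set Implicit Arguments.
Unset Strict Implicit.
Unset Printing Implicit Defensive.

(** * Inner products and the real norm *)

Lemma norm_realC {R : realType} (s : R) : `|s%:C| = `|s|%:C.
Proof. by rewrite normc_def /= expr0n addr0 sqrtr_sqr. Qed.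

Lemma realC_conj {R : realType} (s : R) : (s%:C)^* = s%:C :> R[i].
Proof. by apply: conj_Creal; apply/complex_realP; exists s. Qed.

Lemma complex_between {R : realType} (z : R[i]) (c : R) : 0 <= z <= c%:C ->
  exists2 t : R, z = t%:C & 0 <= t <= c.
Proof.
move=> /andP[z0 zc]; have zE := RRe_real (ger0_real z0).
by exists (complex.Re z); rewrite ?zE // -!lecR zE z0.
Qed.

Section InnerProduct.
Context {R : realType} {H : hilbertType R}.
Implicit Types (x y z : H) (a : R[i]).

Lemma innerDl x y z : '<<x + y, z>> = '<<x, z>> + '<<y, z>>.
Proof. exact: linearDl. Qed.

Lemma innerNl x z : '<<- x, z>> = - '<<x, z>>.
Proof. exact: linearNl. Qed.

Lemma innerBl x y z : '<<x - y, z>> = '<<x, z>> - '<<y, z>>.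
Proof. exact: linearBl. Qed.

Lemma innerZl a x z : '<<a *: x, z>> = a * '<<x, z>>.
Proof. exact: linearZl_LR. Qed.

Lemma inner0l z : '<<0, z>> = 0.
Proof. exact: linear0l. Qed.

Lemma innerC x y : '<<x, y>> = ('<<y, x>>)^*.
Proof. by rewrite {1}/inner hermC expr0 mul1r. Qed.

Lemma innerDr z x y : '<<z, x + y>> = '<<z, x>> + '<<z, y>>.
Proof. exact: linearDr. Qed.

Lemma innerNr z x : '<<z, - x>> = - '<<z, x>>.
Proof. exact: linearNr. Qed.

Lemma innerBr z x y : '<<z, x - y>> = '<<z, x>> - '<<z, y>>.
Proof. exact: linearBr. Qed.

Lemma innerZr a z x : '<<z, a *: x>> = a^* * '<<z, x>>.
Proof. exact: linearZr_LR. Qed.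

Lemma inner0r z : '<<z, 0>> = 0.
Proof. exact: linear0r. Qed.

Lemma inner_suml I (r : seq I) (P : pred I) (F : I -> H) z :
  '<<\sum_(i <- r | P i) F i, z>> = \sum_(i <- r | P i) '<<F i, z>>.
Proof. exact: linear_sumlz. Qed.

Lemma inner_sumr I (r : seq I) (P : pred I) (F : I -> H) z :
  '<<z, \sum_(i <- r | P i) F i>> = \sum_(i <- r | P i) '<<z, F i>>.
Proof. exact: linear_sumr. Qed.

Lemma inner_eq0C x y : '<<x, y>> = 0 -> '<<y, x>> = 0.
Proof. by rewrite innerC => xy; rewrite -[LHS]conjCK xy conjC0. Qed.

(** The norm of the scalar field is itself complex valued; [nr] is the norm as
    a real number, so that infima and epsilons live in [R]. *)
Definition nr x : R := complex.Re `|x|.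

Lemma nrE x : `|x| = (nr x)%:C.
Proof. by rewrite /nr RRe_real // ger0_real. Qed.

Lemma inner_nr x : '<<x, x>> = (nr x ^+ 2)%:C.
Proof. by rewrite /inner -normr_hinner nrE rmorphXn. Qed.

Lemma nr_ge0 x : 0 <= nr x.
Proof. by rewrite -ler0c -nrE. Qed.

Lemma nr_eq0 x : nr x = 0 -> x = 0.
Proof. by move=> x0; apply/eqP; rewrite -normr_eq0 nrE x0. Qed.

Lemma nr0 : nr (0 : H) = 0.
Proof. by apply/complexI; rewrite -nrE normr0. Qed.

Lemma ler_nrD x y : nr (x + y) <= nr x + nr y.
Proof. by rewrite -lecR rmorphD /= -!nrE ler_normD. Qed.

Lemma nrN x : nr (- x) = nr x.
Proof. by apply/complexI; rewrite -!nrE normrN. Qed.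

Lemma nr_dist x y : nr (x - y) = nr (y - x).
Proof. by rewrite -nrN opprB. Qed.

Lemma ler_nr_add x y z : nr (x - z) <= nr (x - y) + nr (y - z).
Proof. by rewrite -[x - z](subrKA y) ler_nrD. Qed.

Lemma nrZ a x : (nr (a *: x))%:C = `|a| * (nr x)%:C.
Proof. by rewrite -!nrE normrZ. Qed.

Lemma nrZR (s : R) x : nr (s%:C *: x) = `|s| * nr x.
Proof. by apply/complexI; rewrite nrZ norm_realC rmorphM. Qed.

Lemma inner_eq0 x : '<<x, x>> = 0 -> x = 0.
Proof.
rewrite inner_nr => /complexI/eqP; rewrite sqrf_eq0 => /eqP; exact: nr_eq0.
Qed.

Lemma inner_ext x y : (forall z, '<<x, z>> = '<<y, z>>) -> x = y.
Proof.
move=> xy; apply/eqP; rewrite -subr_eq0; apply/eqP/inner_eq0.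
by rewrite innerBl xy subrr.
Qed.

Lemma nr_sqrD_orth x y :
  '<<x, y>> = 0 -> nr (x + y) ^+ 2 = nr x ^+ 2 + nr y ^+ 2.
Proof.
move=> xy; apply/complexI; rewrite rmorphD /= -!inner_nr.
by rewrite innerDl !innerDr xy (inner_eq0C xy) addr0 add0r.
Qed.

Lemma parallelogram x y :
  nr (x + y) ^+ 2 + nr (x - y) ^+ 2 = 2 * (nr x ^+ 2 + nr y ^+ 2).
Proof.
apply/complexI; rewrite rmorphD [RHS]rmorphM [X in _ * X]rmorphD rmorph_nat /=.
rewrite -!inner_nr !(innerDl, innerDr, innerNl, innerNr); ring.
Qed.

Lemma nr_orth_le x y : '<<x, y>> = 0 -> nr x <= nr (x + y).
Proof.
move=> xy; rewrite -(ler_pXn2r (n := 2)) ?nnegrE ?nr_ge0 // nr_sqrD_orth //.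
by rewrite lerDl sqr_ge0.
Qed.

Lemma CauchySchwarz x y : `|'<<x, y>>| <= (nr x * nr y)%:C.
Proof.
have [->|y0] := eqVneq y 0.
  by rewrite inner0r normr0 ler0c mulr_ge0 ?nr_ge0.
have nry : nr y != 0 by apply: contra_neq y0; exact: nr_eq0.
have yy : '<<y, y>> != 0 by apply: contra_neq y0; exact: inner_eq0.
set a := '<<x, y>> / '<<y, y>>.
have orth : '<<a *: y, x - a *: y>> = 0.
  by rewrite inner_eq0C // innerBl !innerZr innerZl /a divfK // subrr.
have := nr_orth_le orth; rewrite addrC subrK => le_x.
have -> : '<<x, y>> = a * '<<y, y>> by rewrite /a divfK.
rewrite normrM inner_nr norm_realC (ger0_norm (sqr_ge0 _)) expr2 rmorphM mulrA.
by rewrite -nrZ -rmorphM lecR ler_wpM2r ?nr_ge0.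
Qed.

End InnerProduct.

(** * Convergence, closed subspaces and orthogonal projections *)

Lemma small_invS {R : realType} (e : R) : 0 < e ->
  exists N, forall n, (N <= n)%N -> n.+1%:R^-1 <= e.
Proof.
move=> e0; have [N _ NP] := near_infty_natSinv_lt (PosNum e0).
by exists N => n /NP /ltW.
Qed.

Lemma eq0_of_small {R : realType} (a : R[i]) (K : R) :
  (forall e : R, 0 < e -> `|a| <= (e * K)%:C) -> a = 0.
Proof.
move=> small; apply/eqP; rewrite -normr_eq0; apply/eqP.
have a_real : (complex.Re `|a|)%:C = `|a| by rewrite RRe_real // ger0_real.
have re0 : 0 <= complex.Re `|a| by rewrite -ler0c a_real.
rewrite -a_real; congr (_ %:C); apply/eqP; rewrite eq_le re0 andbT.
have K0 : 0 <= K.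
  by have := small _ ltr01; rewrite -a_real lecR mul1r; apply: le_trans.
apply/ler_addgt0Pl => e e0; rewrite addr0.
have K1 : 0 < K + 1 by rewrite ltr_wpDl.
have := small _ (divr_gt0 e0 K1); rewrite -a_real lecR => /le_trans; apply.
by rewrite mulrAC ler_pdivrMr // ler_pM2l // lerDl.
Qed.

Section HilbertTopology.
Context {R : realType} {H : hilbertType R}.
Implicit Types (x y z : H) (u v : nat -> H) (M B : set H) (T : H -> H).

Lemma cvg_nrP u (l : H) :
  u @ \oo --> l <->
  forall e : R, 0 < e -> exists N, forall n, (N <= n)%N -> nr (l - u n) <= e.
Proof.
split=> [/cvgrPdist_le cv e e0|cv].
  have [|N _ NP] := cv e%:C; first by rewrite ltcR.
  by exists N => n /NP /=; rewrite nrE lecR.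
apply/cvgrPdist_le => e e0.
have eE : (complex.Re e)%:C = e by rewrite RRe_real // gtr0_real.
have [|N NP] := cv (complex.Re e); first by rewrite -ltcR eE.
by exists N => // n /NP; rewrite nrE -lecR eE.
Qed.

Lemma closureP M x :
  closure M x <-> forall e : R, 0 < e -> exists2 y, M y & nr (x - y) <= e.
Proof.
split=> [clx e e0|clx B /nbhs_ballP[e /= e0 eB]].
  have [|y [My]] := clx (ball x e%:C).
    by apply: nbhsx_ballx; rewrite ltcR.
  by rewrite -ball_normE /= nrE ltcR => /ltW ?; exists y.
have eE : (complex.Re e)%:C = e by rewrite RRe_real // gtr0_real.
have [|y My xy] := clx (complex.Re e / 2).
  by rewrite divr_gt0 // -ltcR eE.
exists y; split=> //; apply: eB; rewrite -ball_normE /= nrE -eE ltcR.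
apply: (le_lt_trans xy); rewrite ltr_pdivrMr // mulr_natr mulr2n ltrDl.
by rewrite -ltcR eE.
Qed.

Lemma cauchy_nr_cvg u :
  (forall e : R, 0 < e -> exists N, forall m n, (N <= m)%N -> (N <= n)%N ->
     nr (u m - u n) <= e) ->
  exists l : H, u @ \oo --> l.
Proof.
move=> cu; apply/cvg_ex; apply/cauchy_cvgP/cauchyP => e e0.
have eE : (complex.Re e)%:C = e by rewrite RRe_real // gtr0_real.
have re0 : 0 < complex.Re e by rewrite -ltcR eE.
have [|N NP] := cu (complex.Re e / 2); first by rewrite divr_gt0.
exists (u N); exists N => // n /= Nn; rewrite -ball_normE /= nrE -eE ltcR.
apply: (le_lt_trans (NP _ _ (leqnn N) Nn)).
by rewrite ltr_pdivrMr // mulr_natr mulr2n ltrDl.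
Qed.

Lemma cvg_inner_eq u v x y w z : u @ \oo --> x -> v @ \oo --> y ->
  (forall n, '<<u n, z>> = '<<w, v n>>) -> '<<x, z>> = '<<w, y>>.
Proof.
move=> /cvg_nrP cu /cvg_nrP cv uv; apply/eqP; rewrite -subr_eq0; apply/eqP.
apply: (@eq0_of_small _ _ (nr z + nr w)) => e e0.
have [[m mP] [n nP]] := (cu _ e0, cv _ e0).
have [mk nk] := (leq_maxl m n, leq_maxr m n); set k := maxn m n in mk nk.
have -> : '<<x, z>> - '<<w, y>> = '<<x - u k, z>> - '<<w, y - v k>>.
  rewrite innerBl innerBr uv; ring.
rewrite mulrDr rmorphD; apply: (le_trans (ler_normB _ _)); apply: lerD.
  by apply: (le_trans (CauchySchwarz _ _)); rewrite lecR ler_wpM2r ?nr_ge0 ?mP.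
apply: (le_trans (CauchySchwarz _ _)).
by rewrite lecR mulrC ler_wpM2r ?nr_ge0 ?nP.
Qed.

Lemma cvg_inner_const u x z a : u @ \oo --> x ->
  (exists N, forall n, (N <= n)%N -> '<<u n, z>> = a) -> '<<x, z>> = a.
Proof.
move=> /cvg_nrP cu [N NP]; apply/eqP; rewrite -subr_eq0; apply/eqP.
apply: (@eq0_of_small _ _ (nr z)) => e e0; have [m mP] := cu _ e0.
rewrite -(NP (maxn N m)) ?leq_maxl // -innerBl.
apply: (le_trans (CauchySchwarz _ _)).
by rewrite lecR ler_wpM2r ?nr_ge0 // mP ?leq_maxr.
Qed.

Lemma closure_orth M x z :
  (forall y, M y -> '<<y, z>> = 0) -> closure M x -> '<<x, z>> = 0.
Proof.
move=> Mz /closureP clx; apply: (@eq0_of_small _ _ (nr z)) => e /clx[y My xy].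
rewrite -[x](subrK y) innerDl (Mz y) // addr0.
by apply: (le_trans (CauchySchwarz _ _)); rewrite lecR ler_wpM2r ?nr_ge0.
Qed.

Lemma closed_subspaceP M :
  closed_subspace M <->
  [/\ M 0, forall a x y, M x -> M y -> M (a *: x + y) &
      forall x, closure M x -> M x].
Proof.
split=> [[[M0 MP] Mcl]|[M0 MP Mcl]].
  split=> [|a x y Mx My|x]; first by have := M0; rewrite inE.
    by have := MP a x y; rewrite !inE; apply.
  by have := proj1 (closure_id M) Mcl => <-.
split; last by apply: Mcl.
by split=> [|a x y]; rewrite !inE //; exact: MP.
Qed.

Section ClosedSubspace.
Context {M : set H} (M_closed : closed_subspace M).

Lemma closed_subspace0 : M 0.
Proof. by have [] := proj1 (closed_subspaceP M) M_closed. Qed.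

Lemma closed_subspaceL a x y : M x -> M y -> M (a *: x + y).
Proof. by have [_ + _] := proj1 (closed_subspaceP M) M_closed; apply. Qed.

Lemma closed_subspaceZ a x : M x -> M (a *: x).
Proof.
by move=> Mx; rewrite -[a *: x]addr0; apply: closed_subspaceL closed_subspace0.
Qed.

Lemma closed_subspaceD x y : M x -> M y -> M (x + y).
Proof. by rewrite -{2}[x]scale1r; exact: closed_subspaceL. Qed.

Lemma closed_subspaceB x y : M x -> M y -> M (x - y).
Proof. by move=> Mx My; rewrite addrC -scaleN1r; exact: closed_subspaceL. Qed.

Lemma closed_subspace_closure x : closure M x -> M x.
Proof. by have [_ _] := proj1 (closed_subspaceP M) M_closed; apply. Qed.

Lemma closed_subspace_cvg u x :
  (forall n, M (u n)) -> u @ \oo --> x -> M x.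
Proof.
move=> Mu /cvg_nrP cu; apply: closed_subspace_closure; apply/closureP => e e0.
by have [N NP] := cu _ e0; exists (u N); rewrite ?NP.
Qed.

(** The projection theorem: a minimising sequence for the distance to [M] is
    Cauchy by the parallelogram identity, and the residuals become orthogonal
    to [M], since subtracting their component along any [z] in [M] cannot
    bring them much closer. *)
Lemma orthogonal_decomposition x : exists2 y, M y & orthocomp M (x - y).
Proof.
pose D := [set nr (x - y) ^+ 2 | y in M].
have D_inf : has_inf D.
  split; first by exists (nr (x - 0) ^+ 2), 0 => //; exact: closed_subspace0.
  by exists 0 => _ [y _ <-]; rewrite sqr_ge0.
have D_le y : M y -> inf D <= nr (x - y) ^+ 2.
  by move=> My; apply: (ge_inf (proj2 D_inf)); exists y.
(* The excess is the square of [1 / (n + 1)] because it will bound the square of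
   a norm. *)
have approx n : exists y, M y /\ nr (x - y) ^+ 2 <= inf D + n.+1%:R^-1 ^+ 2.
  have [|_ [y My <-] yP] := @inf_adherent _ D (n.+1%:R^-1 ^+ 2) _ D_inf.
    by rewrite exprn_gt0 // invr_gt0.
  by exists y; split=> //; exact: ltW.
have [u uP] := choice approx.
have [|l ul] := @cauchy_nr_cvg u.
  move=> e e0; have [|N NP] := @small_invS _ (e / 2); first by rewrite divr_gt0.
  exists N => m n /NP Nm /NP Nn.
  rewrite -(ler_pXn2r (n := 2)) ?nnegrE ?nr_ge0 ?(ltW e0) //.
  have [[Mm um] [Mn un]] := (uP m, uP n).
  have := parallelogram (x - u m) (x - u n).
  have -> : x - u m - (x - u n) = - (u m - u n) by rewrite !opprB addrC subrKA.
  rewrite nrN.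
  have -> : x - u m + (x - u n) = 2%:R%:C *: (x - 2^-1%:C *: (u m + u n)).
    rewrite scalerBr scalerA -rmorphM divff ?pnatr_eq0 // scale1r.
    by rewrite rmorph_nat scaler_nat mulr2n opprD addrACA.
  rewrite nrZR normr_nat exprMn.
  have /D_le := closed_subspaceZ (2^-1%:C) (closed_subspaceD Mm Mn).
  have sq k : k.+1%:R^-1 <= e / 2 -> k.+1%:R^-1 ^+ 2 <= (e / 2) ^+ 2.
    by move=> ke; rewrite ler_pXn2r ?nnegrE ?invr_ge0 ?divr_ge0 // ltW.
  have := sq _ Nm; have := sq _ Nn; rewrite expr_div_n.
  move: um un; move: (inf D) (m.+1%:R^-1) (n.+1%:R^-1) => d p q; lra.
exists l; first by apply: closed_subspace_cvg ul => n; have [] := uP n.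
move=> z Mz; apply: (@eq0_of_small _ _ (2 * nr z)) => e e0.
have [N NP] := proj1 (cvg_nrP _ _) ul _ e0.
have [n nP] := small_invS e0.
have [Nk nk] := (leq_maxl N n, leq_maxr N n); set k := maxn N n in Nk nk.
have [Mk uk] := uP k; set r := x - u k in uk.
have [->|z0] := eqVneq z 0.
  by rewrite inner0r normr0 ler0c nr0 !mulr0.
have zz : '<<z, z>> != 0 by apply: contra_neq z0; exact: inner_eq0.
set a := '<<r, z>> / '<<z, z>>.
have orth : '<<a *: z, r - a *: z>> = 0.
  by rewrite inner_eq0C // innerBl !innerZr innerZl /a divfK // subrr.
have az : nr (a *: z) <= e.
  have := nr_sqrD_orth orth; rewrite addrC subrK => rE.
  have /D_le := closed_subspaceL a Mz Mk.
  rewrite opprD addrA -/r [x - _ - _]addrAC -/r => dist.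
  apply: le_trans (nP _ nk).
  rewrite -(ler_pXn2r (n := 2)) ?nnegrE ?nr_ge0 ?invr_ge0 //.
  by move: rE dist uk; move: (inf D) (k.+1%:R^-1) => d p; lra.
rewrite -[x - l](subrKA (u k)) -/r innerDl.
have -> : '<<r, z>> = '<<a *: z, z>> by rewrite innerZl /a divfK.
rewrite [e * _]mulrCA mulr2n mulrDl mul1r.
rewrite rmorphD; apply: (le_trans (ler_normD _ _)); apply: lerD.
  by apply: (le_trans (CauchySchwarz _ _)); rewrite lecR ler_wpM2r ?nr_ge0.
apply: (le_trans (CauchySchwarz _ _)).
by rewrite lecR ler_wpM2r ?nr_ge0 // nr_dist NP.
Qed.

End ClosedSubspace.

Lemma closed_subspaceT : closed_subspace [set: H].
Proof. by apply/closed_subspaceP. Qed.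

Lemma closed_subspaceI M N :
  closed_subspace M -> closed_subspace N -> closed_subspace (M `&` N).
Proof.
move=> Mc Nc; apply/closed_subspaceP; split.
- by split; apply: closed_subspace0.
- by move=> a x y [Mx Nx] [My Ny]; split; apply: closed_subspaceL.
by move=> x /closureI[Mx Nx]; split; apply: closed_subspace_closure.
Qed.

Lemma closed_subspace_orthocomp B : closed_subspace (orthocomp B).
Proof.
apply/closed_subspaceP; split=> [y _|a x y xB yB z Bz|x clx z Bz].
- exact: inner0l.
- by rewrite innerDl innerZl xB // yB // mulr0 addr0.
by apply: closure_orth clx => y yB; exact: yB.
Qed.

Lemma closed_subspace_closure_span B : closed_subspace (closure (lin_span B)).
Proof.
apply/closed_subspaceP; split.
- apply: subset_closure; exists 0%N, (fun=> 0), (fun=> 0).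
  by split=> [[]//|]; rewrite big_ord0.
- move=> a x y /closureP clx /closureP cly; apply/closureP => e e0.
  have n1 : 0 < complex.Re `|a| + 1.
    by rewrite ltr_wpDl // -ler0c RRe_real // ger0_real.
  have [|_ [n [c [v [Bv ->]]]] xv] := clx (e / 2 / (complex.Re `|a| + 1)).
    by rewrite !divr_gt0.
  have [|_ [m [d [w [Bw ->]]]] yw] := cly (e / 2); first by rewrite divr_gt0.
  exists (a *: (\sum_(i < n) c i *: v i) + \sum_(i < m) d i *: w i).
    exists (n + m)%N, (fun i : 'I_(n + m) => match fintype.split i with
      inl j => a * c j | inr j => d j end),
      (fun i : 'I_(n + m) => match fintype.split i with
      inl j => v j | inr j => w j end).
    split; first by move=> i; case: splitP.
    rewrite big_split_ord /= scaler_sumr; congr (_ + _); apply: eq_bigr => i _.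
      by rewrite (unsplitK (inl i)) scalerA.
    by rewrite (unsplitK (inr i)).
  rewrite opprD addrACA -scalerBr [e]splitr.
  apply: (le_trans (ler_nrD _ _)); apply: lerD => //.
  rewrite -lecR nrZ -[`|a|]RRe_real ?ger0_real // -rmorphM lecR.
  have re0 : 0 <= complex.Re `|a| by rewrite -ler0c RRe_real // ger0_real.
  apply: (le_trans (ler_wpM2l re0 xv)).
  rewrite mulrCA ler_piMr ?divr_ge0 ?(ltW e0) // ler_pdivrMr // mul1r.
  by rewrite lerDl.
by move=> x; exact: (@closed_closure _ (lin_span B)).
Qed.

Lemma sub_closure_span B : B `<=` closure (lin_span B).
Proof.
move=> x Bx; apply: subset_closure; exists 1%N, (fun=> 1), (fun=> x).
by split=> //; rewrite big_ord1 scale1r.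
Qed.

Lemma closure_span_min B M :
  closed_subspace M -> B `<=` M -> closure (lin_span B) `<=` M.
Proof.
move=> Mc BM x clx; apply: closed_subspace_closure => //.
apply: closureS clx => _ [n [c [v [Bv ->]]]].
by elim/big_ind: _ => [||i _]; [exact: closed_subspace0
  |exact: closed_subspaceD|apply: closed_subspaceZ => //; exact: BM].
Qed.

End HilbertTopology.

(** * Diagonalization of symmetric operators with enough eigenvectors *)

Section Diagonalization.
Context {R : realType} {H : hilbertType R}.
Implicit Types (M N B : set H) (T : H -> H).

Lemma orthonormal_basis_total M B h : orthonormal_basis M B -> M h ->
  (forall e, B e -> '<<h, e>> = 0) -> h = 0.
Proof.
move=> [_ _ BcM] Mh h_orth; apply: inner_eq0.
have hB : B `<=` orthocomp [set h].
  by move=> e Be _ ->; apply: inner_eq0C; exact: h_orth.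
have : orthocomp [set h] h.
  by apply: (closure_span_min (closed_subspace_orthocomp _) hB); rewrite BcM.
exact.
Qed.

(** For symmetric operators the existence of an eigenbasis is equivalent to
    this property, which, unlike a basis, passes easily through isometries,
    projections and polynomial relations between operators. *)
Definition total_eigenvectors M T :=
  forall h, M h ->
    (forall v a, M v -> T v = a *: v -> '<<h, v>> = 0) -> h = 0.

Definition symmetric_on M T :=
  forall x y, M x -> M y -> '<<T x, y>> = '<<x, T y>>.

Lemma diagonalizable_total M T :
  diagonalizable_on M T -> total_eigenvectors M T.
Proof.
move=> [B Bb Beig] h Mh h_orth; have [BM _ _] := Bb.
apply: orthonormal_basis_total (Bb) Mh _ => e Be.
by have [a ea] := Beig e Be; exact: h_orth (BM _ Be) ea.
Qed.

(** Both [T n - a n] and [T (v - n) - a (v - n)] vanish, since they add up to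
    zero while the first lies in [N] and the second is orthogonal to [N]. *)
Lemma eigenvector_component N T v n (a : R[i]) : closed_subspace N ->
  N n -> N (T n) -> orthocomp N (v - n) -> orthocomp N (T (v - n)) ->
  T (v - n) = T v - T n -> T v = a *: v -> T n = a *: n.
Proof.
move=> Nc Nn NTn vn Tvn TB va.
apply/eqP; rewrite -subr_eq0; apply/eqP/inner_eq0; set z := T n - _.
have Nz : N z by apply: closed_subspaceB => //; exact: closed_subspaceZ.
have zE : z = - (T (v - n) - a *: (v - n)).
  by rewrite TB va scalerBr /z opprB opprB [RHS]addrC subrKA.
by rewrite {1}zE innerNl innerBl Tvn // innerZl vn // mulr0 subrr oppr0.
Qed.

Section Symmetric.
Context {M : set H} {T : H -> H}.
Hypotheses (M_closed : closed_subspace M) (MT : forall x, M x -> M (T x)).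
Hypothesis T_sym : symmetric_on M T.

Lemma symmetric_linear a x y : M x -> M y -> T (a *: x + y) = a *: T x + T y.
Proof.
move=> Mx My; apply/eqP; rewrite -subr_eq0; apply/eqP/inner_eq0.
set z := _ - _; have Mxy := closed_subspaceL M_closed a Mx My.
have Mz : M z.
  apply: closed_subspaceB => //; first exact: MT.
  by apply: closed_subspaceL => //; exact: MT.
rewrite {1}/z innerBl innerDl innerZl !T_sym // innerDl innerZl.
by rewrite subrr.
Qed.

Let orthonormal_eigenvectors : set (set H) :=
  [set B | [/\ B `<=` M, orthonormal_system B id &
               forall e, B e -> exists a : R[i], T e = a *: e]].

(** Take a maximal orthonormal set of eigenvectors.  If its span were not
    dense, its complement [N] in [M] would be a nonzero reducing subspace; some
    eigenvector is not orthogonal to [N], and its component in [N] is again an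
    eigenvector. *)
Lemma total_diagonalizable : total_eigenvectors M T -> diagonalizable_on M T.
Proof.
move=> total.
have [F FP F_tot|B [[BM Bon Beig] Bmax]] :=
    @Zorn_bigcup _ orthonormal_eigenvectors.
  split.
  - by move=> e [B /FP[BM _ _] Be]; exact: BM.
  - move=> e f [B FB Be] [C FC Cf].
    have [[_ Bon _] [_ Con _]] := (FP _ FB, FP _ FC).
    by have [BC|CB] := F_tot _ _ FB FC; [apply: Con; first exact: BC
      | apply: Bon; last exact: CB].
  - by move=> e [B /FP[_ _ Beig] Be]; exact: Beig.
pose N := M `&` orthocomp B.
have Nc : closed_subspace N.
  exact: closed_subspaceI (closed_subspace_orthocomp B).
have NT x : N x -> N (T x).
  move=> [Mx xB]; split; first exact: MT.
  move=> e Be; have [a ea] := Beig _ Be.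
  by rewrite T_sym //; [rewrite ea innerZr xB // mulr0 | exact: BM].
have N0 h : N h -> h = 0.
  move=> Nh; have [Mh _] := Nh; apply: total => // v a Mv va.
  have [n Nn vn] := orthogonal_decomposition Nc v.
  have [Mn nB] := Nn; have Mn' := closed_subspaceB M_closed Mv Mn.
  have nE : T n = a *: n.
    have TB : T (v - n) = T v - T n.
      by rewrite -scaleN1r addrC symmetric_linear // addrC scaleN1r.
    apply: eigenvector_component Nc Nn (NT _ Nn) (vn) _ TB va.
    move=> x Nx; have [Mx _] := Nx.
    by rewrite T_sym //; apply: (vn); exact: NT.
  have [n0|n0] := eqVneq n 0.
    by move: vn; rewrite n0 subr0 => vn; apply/inner_eq0C/vn.
  have nn0 : nr n != 0 by apply: contra_neq n0; exact: nr_eq0.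
  pose e := (nr n)^-1%:C *: n.
  have ee : '<<e, e>> = 1.
    rewrite inner_nr /e nrZR ger0_norm ?invr_ge0 ?nr_ge0 // mulVf //.
    by rewrite expr1n.
  have Ne : N e by exact: closed_subspaceZ.
  have [Me eB] := Ne.
  have Be : ~ B e by move=> /eB; rewrite ee => /eqP; rewrite oner_eq0.
  case: (Bmax (B `|` [set e])).
    split; last by move=> /(_ e) /(_ (or_intror erefl)).
    by move=> x; left.
  split.
  - by move=> x [/BM|->].
  - move=> i j [Bi|->] [Bj|->]; first exact: Bon.
    + rewrite (inner_eq0C (eB _ Bi)); case: eqP => // ie.
      by case: Be; rewrite -ie.
    + rewrite eB //; case: eqP => // ej.
      by case: Be; rewrite ej.
    by rewrite ee eqxx.
  - move=> x [/Beig//|->]; exists a; rewrite /e.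
    have := symmetric_linear (nr n)^-1%:C Mn (closed_subspace0 M_closed).
    rewrite addr0 => ->.
    have T0 : T 0 = 0.
      have := symmetric_linear 1 (closed_subspace0 M_closed)
        (closed_subspace0 M_closed).
      rewrite !scale1r addr0 => /eqP.
      by rewrite -subr_eq0 opprD addNKr oppr_eq0 => /eqP.
    by rewrite T0 addr0 nE !scalerA mulrC.
exists B => //; split=> //; apply/seteqP; split.
  exact: closure_span_min.
move=> x Mx.
have Kc := closed_subspace_closure_span B.
have [k Kk xk] := orthogonal_decomposition Kc x.
suff /N0 /eqP : N (x - k) by rewrite subr_eq0 => /eqP ->.
split; first exact: closed_subspaceB (closure_span_min M_closed BM Kk).
by move=> e Be; apply: xk; exact: sub_closure_span.
Qed.

End Symmetric.
End Diagonalization.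

(** * Symmetric and positive operators *)

Section PositiveOperators.
Context {R : realType} {H : hilbertType R}.
Implicit Types (x y z : H) (E : set H) (T A : H -> H).

Definition symmetric T := symmetric_on [set: H] T.

Lemma symmetricP T a x y : symmetric T -> T (a *: x + y) = a *: T x + T y.
Proof. by move=> Ts; apply: (symmetric_linear closed_subspaceT _ Ts). Qed.

Lemma symmetricD T x y : symmetric T -> T (x + y) = T x + T y.
Proof.
by move=> Ts; have := symmetricP 1 x y Ts; rewrite !scale1r.
Qed.

Lemma symmetric0 T : symmetric T -> T 0 = 0.
Proof.
by move=> Ts; apply/inner_eq0; rewrite Ts // inner0l.
Qed.

Lemma symmetricZ T a x : symmetric T -> T (a *: x) = a *: T x.
Proof.
by move=> Ts; have := symmetricP a x 0 Ts; rewrite (symmetric0 Ts) !addr0.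
Qed.

Lemma symmetricB T x y : symmetric T -> T (x - y) = T x - T y.
Proof.
by move=> Ts; rewrite (symmetricD _ _ Ts) -scaleN1r (symmetricZ _ _ Ts) scaleN1r.
Qed.

(** For [r^2 = t], [r > 0], the vector [A h - r h] would be an eigenvector of
    [A] for [- r], against positivity, unless it is zero; for [r = 0] use
    [|A h|^2 = t |h|^2]. *)
Lemma positive_sqrt_eigenvector A h (t : R[i]) :
  symmetric A -> (forall u, 0 <= '<<A u, u>>) -> A (A h) = t *: h ->
  h != 0 -> 0 <= t /\ A h = sqrtC t *: h.
Proof.
move=> As A0 AAh h0.
have hh : 0 < '<<h, h>>.
  rewrite inner_nr ltcR exprn_gt0 // lt_neqAle nr_ge0 andbT eq_sym.
  by apply: contra_neq h0; exact: nr_eq0.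
have tE : t * '<<h, h>> = '<<A h, A h>> by rewrite -innerZl -AAh As.
have t0 : 0 <= t.
  by rewrite -(pmulr_lge0 _ hh) tE inner_nr ler0c sqr_ge0.
split=> //; set r := sqrtC t; have r0 : 0 <= r by rewrite sqrtC_ge0.
have rr : r * r = t by rewrite -expr2 sqrtCK.
have [r00|rN0] := eqVneq r 0.
  rewrite r00 scale0r; apply: inner_eq0; rewrite -tE -rr r00.
  by rewrite !mul0r.
pose u := A h - r *: h.
have Au : A u = - (r *: u).
  rewrite /u (symmetricB _ _ As) (symmetricZ _ _ As) AAh scalerBr scalerA rr.
  by rewrite opprB.
have : '<<u, u>> <= 0.
  rewrite -(pmulr_rle0 _ (_ : 0 < r)) ?lt_def ?rN0 //.
  by rewrite -innerZl -[r *: u]opprK -Au innerNl oppr_le0.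
rewrite inner_nr -[0]/(0%:C) lecR => uu.
have /eqP : nr u ^+ 2 = 0 by apply/eqP; rewrite eq_le uu sqr_ge0.
rewrite sqrf_eq0 => /eqP/nr_eq0/eqP.
by rewrite subr_eq0 => /eqP.
Qed.

Definition invariant_subspace E T :=
  (forall a x y, E x -> E y -> E (a *: x + y)) /\ (forall x, E x -> E (T x)).

(** Expand [0 <= <A u, u>] at [u = h - A h / b]. *)
Lemma nr_sqr_bounded_form E A (b : R) :
  symmetric A -> invariant_subspace E A -> 0 < b ->
  (forall u, E u -> exists2 t : R, '<<A u, u>> = t%:C &
     0 <= t <= b * nr u ^+ 2) ->
  forall h t, E h -> '<<A h, h>> = t%:C -> nr (A h) ^+ 2 <= b * t.
Proof.
move=> As [EL EA] b0 bd h t Eh th.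
have EAh := EA _ Eh.
pose u := (- b^-1)%:C *: A h + h.
have [s sE /andP[s0 _]] := bd u (EL _ _ _ EAh Eh).
have [p pE /andP[_ pb]] := bd (A h) EAh.
have : s = t - 2 * b^-1 * nr (A h) ^+ 2 + b^-1 ^+ 2 * p.
  apply: complexI; rewrite -sE /u (symmetricP _ _ _ As).
  rewrite innerDl !innerDr !innerZl !innerZr.
  rewrite realC_conj pE th As // inner_nr.
  rewrite !(rmorphD, rmorphM, rmorphN, rmorphXn) /=.
  by rewrite rmorph1; ring.
move: pb; rewrite -(ler_pM2l (_ : 0 < b^-1 ^+ 2)) ?exprn_gt0 ?invr_gt0 //.
have -> : b^-1 ^+ 2 * (b * nr (A h) ^+ 2) = b^-1 * nr (A h) ^+ 2.
  by rewrite mulrA expr2 mulfVK ?gt_eqF.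
move=> pb sE'.
rewrite -ler_pdivrMl //; move: s0 pb; rewrite sE'.
by move: (b^-1 ^+ 2 * p) => q; lra.
Qed.

(** The infimum of the numerical range is an approximate eigenvalue: for
    [A - m >= 0] a small value of the quadratic form at [h] forces [A h - m h]
    to be small. *)
Lemma inf_numerical_range E A (b : R) :
  symmetric A -> invariant_subspace E A -> 0 < b ->
  (forall u, E u -> exists2 t : R, '<<A u, u>> = t%:C &
     0 <= t <= b * nr u ^+ 2) ->
  (exists2 h, E h & h != 0) ->
  exists m : R, [/\ 0 <= m <= b,
    forall h t, E h -> '<<A h, h>> = t%:C -> m * nr h ^+ 2 <= t &
    forall e : R, 0 < e ->
      exists h, [/\ E h, nr h = 1 & nr (A h - m%:C *: h) <= e]].
Proof.
move=> As Einv b0 bd [h0 Eh0 h0N]; have [EL EA] := Einv.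
have E0 : E 0 by rewrite -(addNr h0) -scaleN1r; exact: EL.
have EZ a x : E x -> E (a *: x) by move=> Ex; rewrite -[_ *: _]addr0; exact: EL.
pose V := [set t : R | exists h, [/\ E h, nr h = 1 & '<<A h, h>> = t%:C]].
have normed h : E h -> h != 0 ->
    exists k, [/\ E k, nr k = 1 & h = (nr h)%:C *: k].
  move=> Eh hN; have n0 : nr h != 0 by apply: contra_neq hN; exact: nr_eq0.
  exists ((nr h)^-1%:C *: h); split; first exact: EZ.
    by rewrite nrZR ger0_norm ?invr_ge0 ?nr_ge0 // mulVf.
  by rewrite scalerA -rmorphM mulfV // scale1r.
have V_inf : has_inf V.
  split.
    have [k [Ek k1 _]] := normed _ Eh0 h0N; have [t tE _] := bd _ Ek.
    by exists t, k.
  by exists 0 => t [h [/bd[s sE /andP[s0 _]] _]]; rewrite sE => /complexI <-.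
exists (inf V); set m := inf V.
have m_le t : V t -> m <= t by move=> Vt; exact: (ge_inf (proj2 V_inf)).
have m0 : 0 <= m.
  apply: lb_le_inf; first exact: (proj1 V_inf).
  by move=> t [h [/bd[s sE /andP[s0 _]] _]]; rewrite sE => /complexI <-.
have m_form h t : E h -> '<<A h, h>> = t%:C -> m * nr h ^+ 2 <= t.
  move=> Eh th; have [h00|hN] := eqVneq h 0.
    by move: th; rewrite h00 nr0 expr0n mulr0 inner0r => /complexI ->.
  have [k [Ek k1 hk]] := normed _ Eh hN; have [s sE _] := bd _ Ek.
  have -> : t = nr h ^+ 2 * s.
    apply: complexI; rewrite -th {1 2}hk (symmetricZ _ _ As).
    rewrite innerZl innerZr realC_conj sE.
    by rewrite mulrA -!rmorphM expr2.
  by rewrite mulrC ler_wpM2l ?sqr_ge0 // m_le //; exists k.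
split=> //.
  rewrite m0 /=; have [t Vt] := proj1 V_inf.
  apply: (le_trans (m_le _ Vt)); case: Vt => h [].
  move=> /bd[s sE /andP[_ sb]] h1; rewrite sE => /complexI <-.
  by rewrite (le_trans sb) // h1 expr1n mulr1.
move=> e e0; pose A' h := A h - m%:C *: h.
have A's : symmetric A'.
  by move=> x y _ _; rewrite /A' innerBl innerBr As // innerZl innerZr realC_conj.
have A'inv : invariant_subspace E A'.
  by split=> // x Ex; rewrite /A' addrC -scaleNr; apply: EL => //; exact: EA.
have formE x t : '<<A x, x>> = t%:C -> '<<A' x, x>> = (t - m * nr x ^+ 2)%:C.
  by move=> tE; rewrite /A' innerBl innerZl tE inner_nr rmorphB [in RHS]rmorphM.
have A'bd u : E u -> exists2 t : R, '<<A' u, u>> = t%:C & 0 <= t <= b * nr u ^+ 2.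
  move=> Eu; have [s sE /andP[_ sb]] := bd _ Eu.
  exists (s - m * nr u ^+ 2); first exact: formE.
  rewrite subr_ge0 m_form //= (le_trans _ sb) // gerBl.
  by rewrite mulr_ge0 ?sqr_ge0.
have [|t [h [Eh h1 tE]] tm] := @inf_adherent _ V (e ^+ 2 / b) _ V_inf.
  by rewrite divr_gt0 ?exprn_gt0.
exists h; split=> //.
rewrite -(ler_pXn2r (n := 2)) ?nnegrE ?nr_ge0 ?(ltW e0) //.
apply: (le_trans (nr_sqr_bounded_form A's A'inv b0 A'bd Eh (formE _ _ tE))).
rewrite -ler_pdivlMl // h1 expr1n mulr1 lerBlDr addrC [_ * e ^+ 2]mulrC.
exact: ltW.
Qed.

End PositiveOperators.

(** * Cosine and sine of a bounded symmetric operator *)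

Section OperatorSeries.
Context {R : realType} {L : hilbertType R}.
Variables (X : {linear L -> L}) (b : R).
Hypotheses (X_sym : symmetric X) (b0 : 0 <= b).
Hypothesis X_bounded : forall h, nr (X h) <= b * nr h.

Lemma nr_sum_le (I : Type) (r : seq I) (P : pred I) (F : I -> L) :
  nr (\sum_(i <- r | P i) F i) <= \sum_(i <- r | P i) nr (F i).
Proof.
elim/big_rec2: _ => [|i y x _ yx]; first by rewrite nr0.
by apply: (le_trans (ler_nrD _ _)); rewrite lerD2l.
Qed.

Lemma iter_symmetric n : symmetric (iter n X).
Proof.
elim: n => [//|n IHn] x y _ _ /=.
by rewrite X_sym // IHn // -iterSr.
Qed.

Lemma nr_iter_le n h : nr (iter n X h) <= b ^+ n * nr h.
Proof.
elim: n => [|n IHn] /=; first by rewrite expr0 mul1r.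
by apply: (le_trans (X_bounded _)); rewrite exprS -mulrA ler_wpM2l.
Qed.

(** [X^n - mu^n] is divisible by [X - mu], with a quotient of norm at most
    [(b + 1)^n]. *)
Lemma nr_iter_sub_le n (mu : R) h : 0 <= mu <= b ->
  nr (iter n X h - (mu ^+ n)%:C *: h) <= (b + 1) ^+ n * nr (X h - mu%:C *: h).
Proof.
move=> /andP[mu0 mub]; set d := nr (X h - _); have d0 : 0 <= d by exact: nr_ge0.
elim: n => [|n IHn] /=.
  by rewrite !expr0 scale1r subrr nr0 mul1r.
have -> : X (iter n X h) - (mu ^+ n.+1)%:C *: h =
    X (iter n X h - (mu ^+ n)%:C *: h) + (mu ^+ n)%:C *: (X h - mu%:C *: h).
  rewrite (symmetricB _ _ X_sym) (symmetricZ _ _ X_sym) [in RHS]scalerBr.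
  rewrite scalerA -rmorphM -exprSr.
  by rewrite subrKA.
apply: (le_trans (ler_nrD _ _)); rewrite exprSr mulrDr mulr1 mulrDl.
apply: lerD; last first.
  rewrite nrZR ger0_norm ?exprn_ge0 // ler_wpM2r // lerXn2r ?nnegrE //.
    by rewrite addr_ge0.
  by rewrite (le_trans mub) // lerDl.
apply: (le_trans (X_bounded _)).
by rewrite [_ * b]mulrC -mulrA ler_wpM2l.
Qed.

Section Coefficients.
Variables (k : nat -> R) (m : nat -> nat) (K c : R).
Hypotheses (K0 : 0 <= K) (c0 : 0 <= c).
Hypothesis k_le : forall n, `|k n| * (b + 1) ^+ m n <= K * exp_coeff c n.

Let term h n : L := (k n)%:C *: iter (m n) X h.

(** The common form of [op_cos] and [op_sin].  The coefficients are dominated by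
    an exponential series at radius [b + 1], not only [b], which is what the
    bound on [X^n - mu^n] needs. *)
Definition op_series h : L := limn (series (term h)).

Let term_le h n : nr (term h n) <= K * exp_coeff c n * nr h.
Proof.
rewrite nrZR; apply: (le_trans (ler_wpM2l (normr_ge0 _) (nr_iter_le _ _))).
rewrite mulrA ler_wpM2r ?nr_ge0 // (le_trans _ (k_le n)) // ler_wpM2l //.
by rewrite lerXn2r ?nnegrE ?addr_ge0 // lerDl.
Qed.

Lemma op_series_cvg h : series (term h) @ \oo --> op_series h.
Proof.
suff [l lP] : exists l : L, series (term h) @ \oo --> l.
  by rewrite /op_series (cvg_lim _ lP).
apply: cauchy_nr_cvg => e e0.
have Kh1 : 0 < K * nr h + 1 by rewrite ltr_wpDl // mulr_ge0 ?nr_ge0.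
have /cvgrPdist_le cexp := is_cvg_series_exp_coeff c.
have [|N _ NP] := cexp (e / (K * nr h + 1) / 2); first by rewrite !divr_gt0.
exists N.
suff half p q : (N <= p)%N -> (p <= q)%N ->
    nr (series (term h) q - series (term h) p) <= e.
  move=> p q Np Nq; have [pq|/ltnW qp] := leqP p q; last exact: half.
  by rewrite nr_dist half.
move=> Np pq; rewrite sub_series_geq //.
apply: (le_trans (nr_sum_le _ _ _)).
apply: (@le_trans _ _ (\sum_(p <= i < q) K * nr h * exp_coeff c i)).
  by apply: ler_sum => i _; rewrite mulrAC term_le.
rewrite -mulr_sumr -sub_series_geq //.
have tail : series (exp_coeff c) q - series (exp_coeff c) p <=
    e / (K * nr h + 1).
  rewrite [X in _ <= X]splitr; have := NP p Np; have := NP q (leq_trans Np pq).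
  move=> /=; set l := limn _; rewrite !ler_norml.
  move: (series _ q) (series _ p) (e / _ / 2) => u v w.
  by move=> /andP[? ?] /andP[? ?]; lra.
apply: (@le_trans _ _ ((K * nr h + 1) * (e / (K * nr h + 1)))); last first.
  by rewrite mulrC divfK // gt_eqF.
apply: (le_trans (ler_wpM2l _ tail)); first by rewrite mulr_ge0 ?nr_ge0.
by rewrite ler_wpM2r ?lerDl // divr_ge0 // ltW.
Qed.

Let series_symmetric N : symmetric (fun h => series (term h) N).
Proof.
move=> x y _ _; rewrite /series /= inner_suml inner_sumr.
apply: eq_bigr => i _.
by rewrite /term innerZl innerZr iter_symmetric // realC_conj.
Qed.

(** Symmetry passes to the limit weakly, with no continuity of [op_series], and
    then implies that [op_series] is linear. *)
Lemma op_series_symmetric : symmetric op_series.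
Proof.
move=> x y _ _; apply: cvg_inner_eq (@op_series_cvg x) (@op_series_cvg y) _.
by move=> N; rewrite series_symmetric.
Qed.

(** Also by weak limits: [X] and the partial sums move across the inner
    product. *)
Lemma op_series_commute h : op_series (X h) = X (op_series h).
Proof.
apply: inner_ext => z; rewrite [LHS]op_series_symmetric // [RHS]X_sym //.
symmetry; apply: cvg_inner_eq (@op_series_cvg h) (@op_series_cvg z) _ => N.
rewrite -[LHS]X_sym // -[RHS](@series_symmetric N) //; congr ('<<_, _>>).
rewrite /series /= linear_sum; apply: eq_bigr => i _.
by rewrite /term linearZ /= -iterSr.
Qed.

Lemma op_series_invariant M h : closed_subspace M ->
  (forall x, M x -> M (X x)) -> M h -> M (op_series h).
Proof.
move=> Mc MX Mh; apply: closed_subspace_cvg (Mc) _ _ _ (@op_series_cvg h) => N.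
rewrite /series /=; apply: (big_ind M) => [|x y|i _].
- exact: (closed_subspace0 Mc).
- exact: (closed_subspaceD Mc).
apply: closed_subspaceZ => //.
by elim: (m i) => [//|p IHp] /=; exact: MX.
Qed.

Lemma nr_series_sub_le N (mu : R) h : 0 <= mu <= b ->
  nr (series (term h) N - (series (fun n => k n * mu ^+ m n) N)%:C *: h) <=
  K * expR c * nr (X h - mu%:C *: h).
Proof.
move=> mub; rewrite /series /= rmorph_sum scaler_suml -sumrB.
apply: (le_trans (nr_sum_le _ _ _)).
apply: (@le_trans _ _
    (\sum_(0 <= i < N) K * exp_coeff c i * nr (X h - mu%:C *: h))).
  apply: ler_sum => i _; rewrite rmorphM -scalerA -scalerBr nrZR.
  apply: (le_trans (ler_wpM2l (normr_ge0 _) (nr_iter_sub_le _ _ mub))).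
  by rewrite mulrA ler_wpM2r ?nr_ge0.
rewrite -mulr_suml ler_wpM2r ?nr_ge0 // -mulr_sumr ler_wpM2l //.
apply: (nondecreasing_cvgn_le _ (is_cvg_series_exp_coeff c)).
by apply: nondecreasing_series => n _ _; exact: exp_coeff_ge0.
Qed.

(** Approximate eigenvectors of [X] at [mu] are approximate eigenvectors of the
    operator series, at the value of the scalar series. *)
Lemma op_series_approx_eigenvalue (a : R[i]) (mu f : R) : 0 <= mu <= b ->
  series (fun n => k n * mu ^+ m n) @ \oo --> f ->
  (forall e : R, 0 < e -> exists h,
     [/\ op_series h = a *: h, nr h = 1 & nr (X h - mu%:C *: h) <= e]) ->
  a = f%:C.
Proof.
move=> mub /cvgrPdist_le cf approx; apply/eqP; rewrite -subr_eq0; apply/eqP.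
apply: (@eq0_of_small _ _ (1 + K * expR c + 1)) => e e0.
have [h [ha h1 Xh]] := approx _ e0.
have /cvg_nrP/(_ _ e0)[p pP] := @op_series_cvg h.
have [q _ qP] := cf _ e0.
have [pN qN] := (leq_maxl p q, leq_maxr p q); set N := maxn p q in pN qN.
have -> : `|a - f%:C| = (nr ((a - f%:C) *: h))%:C by rewrite nrZ h1 mulr1.
rewrite lecR scalerBl -ha.
apply: (le_trans (ler_nr_add _ (series (term h) N) _)).
rewrite -addrA mulrDr mulr1; apply: lerD; first exact: pP.
apply: (le_trans (ler_nr_add _
  ((series (fun n => k n * mu ^+ m n) N)%:C *: h) _)).
rewrite mulrDr mulr1; apply: lerD.
  apply: (le_trans (nr_series_sub_le _ _ mub)).
  by rewrite mulrC ler_wpM2r // mulr_ge0 // expR_ge0.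
rewrite -scalerBl -rmorphB nrZR h1 mulr1 distrC; exact: (qP _ qN).
Qed.

End Coefficients.

Lemma exp_coeff_fact_le (r : R) n : 0 <= r ->
  r ^+ n.*2 / n.*2`!%:R <= exp_coeff (r ^+ 2) n.
Proof.
move=> r0; rewrite /exp_coeff /= -exprM mul2n ler_wpM2l ?exprn_ge0 //.
rewrite lef_pV2 ?posrE ?ltr0n ?fact_gt0 // ler_nat leq_fact //.
by rewrite -addnn leq_addr.
Qed.

Let b1 : 0 <= b + 1. Proof. by rewrite addr_ge0. Qed.
Let sign_fact (n p : nat) : `|(-1) ^+ n / p`!%:R : R| = p`!%:R^-1.
Proof. by rewrite normrM normrX normrN1 expr1n mul1r ger0_norm ?invr_ge0. Qed.

Let cos_k (n : nat) : R := (-1) ^+ n / n.*2`!%:R.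
Let sin_k (n : nat) : R := (-1) ^+ n / n.*2.+1`!%:R.

Let cos_k_le n : `|cos_k n| * (b + 1) ^+ n.*2 <= 1 * exp_coeff ((b + 1) ^+ 2) n.
Proof. by rewrite sign_fact mul1r mulrC exp_coeff_fact_le. Qed.

Let sin_k_le n :
  `|sin_k n| * (b + 1) ^+ n.*2.+1 <= (b + 1) * exp_coeff ((b + 1) ^+ 2) n.
Proof.
rewrite sign_fact exprS mulrCA ler_wpM2l // mulrC.
apply: le_trans (exp_coeff_fact_le _ b1).
rewrite ler_wpM2l ?exprn_ge0 // lef_pV2 ?posrE ?ltr0n ?fact_gt0 // ler_nat.
exact: leq_fact.
Qed.

Let op_cosE : op_cos X = op_series cos_k double.
Proof.
apply/funext => h; congr (lim (series _ @ \oo)); apply/funext => n.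
by rewrite /cos_k rmorphM rmorphXn rmorphN1 fmorphV rmorph_nat.
Qed.

Let op_sinE : op_sin X = op_series sin_k (fun n => n.*2.+1).
Proof.
apply/funext => h; congr (lim (series _ @ \oo)); apply/funext => n.
by rewrite /sin_k rmorphM rmorphXn rmorphN1 fmorphV rmorph_nat.
Qed.

Lemma op_cos_symmetric : symmetric (op_cos X).
Proof. by rewrite op_cosE; apply: op_series_symmetric cos_k_le. Qed.

Lemma op_sin_symmetric : symmetric (op_sin X).
Proof. by rewrite op_sinE; apply: op_series_symmetric sin_k_le. Qed.

Lemma op_cos_commute h : op_cos X (X h) = X (op_cos X h).
Proof. by rewrite op_cosE; apply: op_series_commute cos_k_le _. Qed.

(** The double orthogonal complement of an eigenvector is the line that it
    spans, a closed invariant subspace. *)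
Lemma eigenvector_op_cos (x : R[i]) e : X e = x *: e ->
  exists a : R[i], op_cos X e = a *: e.
Proof.
move=> xe; have [->|e0] := eqVneq e 0.
  by exists 0; rewrite scaler0 (symmetric0 op_cos_symmetric).
pose M := orthocomp (orthocomp [set e]).
have MC : M (op_cos X e).
  rewrite op_cosE; apply: (op_series_invariant ler01 cos_k_le (M := M)).
  - exact: closed_subspace_orthocomp.
  - move=> y My z ze; rewrite X_sym //; apply: My => _ ->.
    by rewrite X_sym // xe innerZr ze // mulr0.
  - by move=> z ze; apply: inner_eq0C; exact: ze.
have ee : '<<e, e>> != 0 by apply: contra_neq e0; exact: inner_eq0.
exists ('<<op_cos X e, e>> / '<<e, e>>); set a := _ / _.
apply/eqP; rewrite -subr_eq0; apply/eqP/inner_eq0.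
have orth : orthocomp [set e] (op_cos X e - a *: e).
  by move=> _ ->; rewrite innerBl innerZl divfK // subrr.
by rewrite {1}innerBl (MC _ orth) innerZl (inner_eq0C (orth e erefl)) mulr0 subrr.
Qed.

Lemma op_cos_approx_eigenvalue (a : R[i]) (mu : R) : 0 <= mu <= b ->
  (forall e : R, 0 < e -> exists h,
     [/\ op_cos X h = a *: h, nr h = 1 & nr (X h - mu%:C *: h) <= e]) ->
  a = (cos mu)%:C.
Proof.
rewrite op_cosE => mub.
apply: op_series_approx_eigenvalue cos_k_le _ _ _ mub _ => //.
  exact: sqr_ge0.
rewrite [X in series X](_ : _ = cos_coeff' mu); first exact: cvg_cos_coeff'.
by apply/funext => n; rewrite /cos_k /cos_coeff' mulrAC.
Qed.

(** The eigenspace of [cos X] for [a] is invariant under [X], both ends of the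
    numerical range of [X] on it are approximate eigenvalues, and [cos] sends
    both of them to [a]; so they agree. *)
Lemma op_cos_eigenvector (a : R[i]) h : 0 < b -> b <= pi ->
  (forall u, 0 <= '<<X u, u>> <= (b * nr u ^+ 2)%:C) ->
  op_cos X h = a *: h -> exists x : R, X h = x%:C *: h.
Proof.
move=> b_gt0 b_pi form ha.
have [->|h0] := eqVneq h 0; first by exists 0; rewrite linear0 scaler0.
pose E := [set u | op_cos X u = a *: u].
have EL c x y : E x -> E y -> E (c *: x + y).
  rewrite /E /= => xE yE; rewrite (symmetricP _ _ _ op_cos_symmetric) xE yE.
  by rewrite scalerDr !scalerA mulrC.
have EX x : E x -> E (X x).
  by rewrite /E /= => xE; rewrite op_cos_commute xE linearZ.
have formR u := complex_between (form u).
(* The upper end of the numerical range of [X] is the lower end for [b - X]. *)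
pose Y u := b%:C *: u - X u.
have Y_sym : symmetric Y.
  by move=> x y _ _; rewrite /Y innerBl innerBr innerZl innerZr realC_conj X_sym.
have EY : invariant_subspace E Y.
  split=> // x Ex; rewrite /Y addrC -scaleN1r; apply: (EL); first exact: EX.
  rewrite -[_ *: x]addr0; apply: EL => //.
  by rewrite /E /= (symmetric0 op_cos_symmetric) scaler0.
have formY u t : '<<X u, u>> = t%:C -> '<<Y u, u>> = (b * nr u ^+ 2 - t)%:C.
  by move=> tE; rewrite /Y innerBl innerZl inner_nr tE rmorphB [in RHS]rmorphM.
have formYR u : E u ->
    exists2 t : R, '<<Y u, u>> = t%:C & 0 <= t <= b * nr u ^+ 2.
  move=> _; have [t tE /andP[t0 tb]] := formR u.
  by exists (b * nr u ^+ 2 - t); rewrite ?(formY _ _ tE) // subr_ge0 tb gerBl.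
have E_n0 : exists2 u, E u & u != 0 by exists h.
have [m [mb mform m_approx]] :=
  inf_numerical_range X_sym (conj EL EX) b_gt0 (fun u _ => formR u) E_n0.
have [p [/andP[p0 pb] pform p_approx]] :=
  inf_numerical_range Y_sym EY b_gt0 formYR E_n0.
have bpb : 0 <= b - p <= b by rewrite subr_ge0 pb gerBl.
have am : a = (cos m)%:C.
  apply: op_cos_approx_eigenvalue mb _ => e /m_approx[u [Eu u1 ue]].
  by exists u.
have ap : a = (cos (b - p))%:C.
  apply: op_cos_approx_eigenvalue bpb _ => e /p_approx[u [Eu u1 ue]].
  exists u; split=> //; rewrite rmorphB scalerBl -nrN opprB.
  by rewrite addrAC.
have mp : m = b - p.
  apply: cos_inj; rewrite ?in_itv /=.
  - by case/andP: mb => -> /le_trans ->.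
  - by case/andP: bpb => -> /le_trans ->.
  by apply: complexI; rewrite -am -ap.
exists m; apply/eqP; rewrite -subr_eq0; apply/eqP/nr_eq0/eqP.
rewrite -sqrf_eq0 eq_le sqr_ge0 andbT.
(* Both ends are [m]: the form of [X - m >= 0] vanishes on [E], which forces
   [X = m] there. *)
pose Z u := X u - m%:C *: u.
have Z_sym : symmetric Z.
  by move=> x y _ _; rewrite /Z innerBl innerBr innerZl innerZr realC_conj X_sym.
have EZ : invariant_subspace E Z.
  by split=> // x Ex; rewrite /Z addrC -scaleNr; apply: EL => //; exact: EX.
have formZ u : E u -> '<<Z u, u>> = 0%:C.
  move=> Eu; have [t tE _] := formR u.
  have := mform _ _ Eu tE; have := pform _ _ Eu (formY _ _ tE).
  rewrite /Z innerBl innerZl inner_nr tE -rmorphM -rmorphB /= => tp tm.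
  by congr (_%:C); move: tp tm; rewrite mp; lra.
have := nr_sqr_bounded_form Z_sym EZ b_gt0 _ ha (formZ _ ha).
rewrite mulr0; apply=> u Eu; exists 0; first exact: formZ.
by rewrite lexx mulr_ge0 ?sqr_ge0.
Qed.

End OperatorSeries.

(** * Halmos decomposition of two projections *)

Section TwoProjections.
Context {R : realType} {H L : hilbertType R}.
Variables (P Q : H -> H) (W : {linear (L * L)%type -> H}) (X : {linear L -> L}).
Hypotheses (P_sym : symmetric P) (P_idem : forall x, P (P x) = P x).
Hypotheses (Q_sym : symmetric Q) (Q_idem : forall x, Q (Q x) = Q x).
Hypothesis halmos : halmos_decomposition P Q W X.

Let C := op_cos X.
Let S := op_sin X.
Let b : R := pi / 2.

Let b_gt0 : 0 < b. Proof. by rewrite divr_gt0 // pi_gt0. Qed.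

Let X_sym : symmetric X.
Proof. by move=> x y _ _; exact: halmos_selfadjoint halmos x y. Qed.

Let X_form u : 0 <= '<<X u, u>> <= (b * nr u ^+ 2)%:C.
Proof.
have := halmos_X_ge0 halmos u; rewrite inner0l => -> /=.
have := halmos_X_le halmos u; rewrite innerZl inner_nr -rmorphM.
exact.
Qed.

Let X_bounded h : nr (X h) <= b * nr h.
Proof.
have formR u := complex_between (X_form u).
have XT : invariant_subspace [set: L] X by [].
have [t tE /andP[_ tb]] := formR h.
rewrite -(ler_pXn2r (n := 2)) ?nnegrE ?nr_ge0 //; last first.
  exact: mulr_ge0 (ltW b_gt0) (nr_ge0 _).
rewrite exprMn expr2 -mulrA.
have bt := nr_sqr_bounded_form X_sym XT b_gt0 (fun u _ => formR u) I tE.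
by apply: (le_trans bt); rewrite ler_wpM2l // ltW.
Qed.

Let C_sym : symmetric C.
Proof. exact: op_cos_symmetric X_sym (ltW b_gt0) X_bounded. Qed.

Let S_sym : symmetric S.
Proof. exact: op_sin_symmetric X_sym (ltW b_gt0) X_bounded. Qed.

Let C_ge0 u : 0 <= '<<C u, u>>.
Proof. by have := halmos_cos_ge0 halmos u; rewrite inner0l. Qed.

Let S_ge0 u : 0 <= '<<S u, u>>.
Proof. by have := halmos_sin_ge0 halmos u; rewrite inner0l. Qed.

Let cos_eigenvector (x : R[i]) e : X e = x *: e ->
  exists a : R[i], C e = a *: e.
Proof. exact: eigenvector_op_cos X_sym (ltW b_gt0) X_bounded x e. Qed.

Let eigenvector_of_cos (a : R[i]) e : C e = a *: e ->
  exists x : R, X e = x%:C *: e.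
Proof.
apply: (op_cos_eigenvector X_sym (ltW b_gt0) X_bounded) => //.
by rewrite /b ler_pdivrMr // ler_peMr ?pi_ge0 // ler1n.
Qed.

Lemma halmos_inner a a' c c' :
  '<<W (a, a'), W (c, c')>> = '<<a, c>> + '<<a', c'>>.
Proof. exact: halmos_isometry halmos a a' c c'. Qed.

Lemma halmos_inj a a' c c' : W (a, a') = W (c, c') -> a = c /\ a' = c'.
Proof.
move=> Weq; split; apply: inner_ext => z.
  have := halmos_inner a a' z 0; rewrite Weq halmos_inner !inner0r !addr0.
  by move=> ->.
have := halmos_inner a a' 0 z; rewrite Weq halmos_inner !inner0r !add0r.
by move=> ->.
Qed.

Lemma halmosZ (a : R[i]) x y : W (a *: x, a *: y) = a *: W (x, y).
Proof. by rewrite -linearZ. Qed.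

(** The two off-diagonal blocks of the selfadjoint [Q] are adjoint to each
    other. *)
Lemma halmos_cos_sin a : C (S a) = S (C a).
Proof.
apply: inner_ext => d; rewrite [RHS]S_sym // [RHS]C_sym //.
have := Q_sym (x := W (a, 0)) (y := W (0, d)) I I.
rewrite !(halmos_Q halmos) -/C -/S !halmos_inner.
rewrite !(symmetric0 S_sym) !(symmetric0 C_sym).
by rewrite !inner0l !inner0r !addr0 !add0r.
Qed.

Lemma halmos_Qcol a : Q (W (a, 0)) = W (C (C a), S (C a)).
Proof.
rewrite (halmos_Q halmos) -/C -/S !(symmetric0 S_sym) (symmetric0 C_sym).
by rewrite !addr0 halmos_cos_sin.
Qed.

Lemma halmos_PQ a : P (Q (W (a, 0))) = W (C (C a), 0).
Proof. by rewrite halmos_Qcol (halmos_P halmos). Qed.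

(** [Q Q = Q] on the first column gives [C (C^2 + S^2) C = C C], and [C] is
    injective and selfadjoint. *)
Lemma halmos_cos2_sin2 a : C (C a) + S (S a) = a.
Proof.
have Cinj : trivial_nullspace C := halmos_cos_inj halmos.
have col x : C (C (C x)) + S (S (C x)) = C x.
  have := Q_idem (W (x, 0)); rewrite halmos_Qcol (halmos_Q halmos) -/C -/S.
  case/halmos_inj => Cx _; apply/eqP; rewrite -subr_eq0; apply/eqP/Cinj.
  by rewrite (symmetricB _ _ C_sym) (symmetricD _ _ C_sym) Cx subrr.
apply/eqP; rewrite -subr_eq0; apply/eqP/Cinj; apply: inner_eq0.
set z := C _; rewrite {1}/z C_sym // innerBl innerDl.
rewrite (@C_sym (C a)) // (@S_sym (S a)) // (@C_sym a) // (@S_sym a) //.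
by rewrite -innerDr col subrr.
Qed.

Lemma halmos_commutator x y :
  commutator P Q (W (x, y)) = W (C (S y), - S (C x)).
Proof.
rewrite /commutator (halmos_Q halmos) !(halmos_P halmos) halmos_Qcol -/C -/S.
by rewrite -linearB; congr (W (_, _)); rewrite ?sub0r // addrAC subrr add0r.
Qed.

Lemma cos_sin2_cos x : C (S (S (C x))) = C (C x) - C (C (C (C x))).
Proof.
by rewrite -(symmetricB _ _ C_sym) -{2}(halmos_cos2_sin2 (C x)) [X in X - _]addrC
  addrK.
Qed.

Let G := generic_part P Q.

Lemma generic_part_closed : closed_subspace G.
Proof. exact: closed_subspace_orthocomp. Qed.

Lemma generic_partP v : G v <-> exists x y, v = W (x, y).
Proof.
rewrite /G -(halmos_onto halmos); split=> [[[x y] _ <-]|[x [y ->]]].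
  by exists x, y.
by exists (x, y).
Qed.

(** The pair [(x, y)] is the component of [v] in the generic part.  Operators
    that are reduced by the generic part, such as polynomials in [P] and [Q],
    keep their eigenvectors when these are replaced by their components. *)
Lemma generic_component v : exists x y,
  [/\ orthocomp G (v - W (x, y)),
   forall u w, '<<W (u, w), v>> = '<<u, x>> + '<<w, y>> &
   forall T T' (a : R[i]), adjoint_pair T T' ->
     (forall h k, T (h - k) = T h - T k) ->
     (forall h, G h -> G (T h) /\ G (T' h)) ->
     T v = a *: v -> T (W (x, y)) = W (a *: x, a *: y)].
Proof.
have [g Gg vg] := orthogonal_decomposition generic_part_closed v.
have /generic_partP[x [y gE]] := Gg; rewrite gE in Gg vg.
exists x, y; split=> // [u w|T T' a TT' TB GT va].
  rewrite -halmos_inner -[v in LHS](subrK (W (x, y))) innerDr.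
  rewrite [X in X + _](inner_eq0C (vg _ _)) ?add0r //.
  by apply/generic_partP; exists u, w.
rewrite halmosZ.
apply: eigenvector_component generic_part_closed (Gg) _ (vg) _ _ va.
- by have [] := GT _ Gg.
- by move=> z Gz; rewrite TT'; apply: (vg); have [] := GT _ Gz.
exact: TB.
Qed.

Lemma generic_part_P h : G h -> G (P h).
Proof.
move=> /generic_partP[x [y ->]]; apply/generic_partP.
by rewrite (halmos_P halmos); exists x, 0.
Qed.

Lemma generic_part_Q h : G h -> G (Q h).
Proof.
move=> /generic_partP[x [y ->]]; apply/generic_partP.
by rewrite (halmos_Q halmos); do 2 eexists.
Qed.

(** The component of [v] in the generic part is some [(x, 0)], as [P] fixes it,
    and [x] is an eigenvector of [C^2]. *)
Lemma range_compression_eigenvector v (t : R[i]) a :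
  P v = v -> P (Q v) = t *: v ->
  (forall e (c : R[i]), (C \o C) e = c *: e -> '<<a, e>> = 0) ->
  '<<W (a, 0), v>> = 0.
Proof.
move=> Pv PQv a_orth; have [x [y [_ -> vW]]] := generic_component v.
have y0 : y = 0.
  have := vW _ _ 1 (fun h k => P_sym I I) (fun h k => symmetricB h k P_sym).
  rewrite Pv (halmos_P halmos) !scale1r => /(_ _)/(_ erefl)/halmos_inj[|_ <-//].
  by move=> h /generic_part_P.
have A_adj : adjoint_pair (fun h => P (Q (P h))) (fun h => P (Q (P h))).
  by move=> h k; rewrite P_sym // Q_sym // P_sym.
have AB h k : P (Q (P (h - k))) = P (Q (P h)) - P (Q (P k)).
  by rewrite (symmetricB _ _ P_sym) (symmetricB _ _ Q_sym) (symmetricB _ _ P_sym).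
have := vW _ _ t A_adj AB.
rewrite Pv y0 (halmos_P halmos) halmos_PQ inner0l addr0.
move=> /(_ _)/(_ PQv)/halmos_inj[h Gh|/a_orth//].
by have := generic_part_P (generic_part_Q (generic_part_P Gh)).
Qed.

Lemma range_compression_definite a :
  '<<P (Q (W (a, 0))), W (a, 0)>> = 0 -> a = 0.
Proof.
rewrite halmos_PQ halmos_inner inner0l addr0 C_sym // => /inner_eq0.
exact: halmos_cos_inj halmos a.
Qed.

Let commutatorB h k :
  commutator P Q (h - k) = commutator P Q h - commutator P Q k.
Proof.
rewrite /commutator !(symmetricB _ _ P_sym, symmetricB _ _ Q_sym).
by rewrite !opprD !opprK addrACA.
Qed.

Let commutator_skew x y :
  '<<commutator P Q x, y>> = '<<x, - commutator P Q y>>.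
Proof.
by rewrite /commutator opprB innerBl innerBr P_sym // Q_sym // Q_sym // P_sym.
Qed.

Let range_fix (T : H -> H) v : (forall x, T (T x) = T x) -> range T v -> T v = v.
Proof. by move=> T_idem [x _ <-]. Qed.

(** On the two summands of the nongeneric part that lie in the range of [P],
    [P Q] is the identity or zero; so a vector of the range orthogonal to all
    eigenvectors is generic, of the form [(a, 0)].  There every eigenvector of
    [X] is one of [C^2]. *)
Lemma total_range_compression :
  total_eigenvectors [set: L] X ->
  total_eigenvectors [set x | P x = x] (P \o Q).
Proof.
move=> X_total h Ph h_orth.
have h_ran v (a : R[i]) : P v = v -> P (Q v) = a *: v -> '<<h, v>> = 0.
  by move=> Pv; exact: h_orth.
have h_null v : P v = 0 -> '<<h, v>> = 0.
  by move=> Pv; rewrite -Ph P_sym // Pv inner0r.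
have /generic_partP[a [y hE]] : G h.
  move=> _ [h11 [h00 [h10 [h01 [[P11 Q11] [P00 _] [P10 Q10] [P01 _] ->]]]]].
  have {}P11 := range_fix P_idem P11; have {}Q11 := range_fix Q_idem Q11.
  have {}P10 := range_fix P_idem P10; rewrite /nullspace /= in P00 P01 Q10.
  rewrite !innerDr (h_ran h11 1) ?Q11 ?scale1r // (h_null h00) // (h_null h01) //.
  rewrite (h_ran h10 0) ?addr0 //.
  by rewrite Q10 (symmetric0 P_sym) scale0r.
have y0 : y = 0.
  have := Ph; rewrite /= hE (halmos_P halmos) => /halmos_inj[_ <-].
  by [].
rewrite hE y0 in h_ran *.
suff -> : a = 0 by rewrite linear0.
apply: X_total => // e x _ /cos_eigenvector[c ce].
have := h_ran (W (e, 0)) (c * c).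
rewrite (halmos_P halmos) halmos_PQ halmos_inner inner0l addr0.
apply=> //; rewrite ce (symmetricZ _ _ C_sym) ce scalerA.
by rewrite -halmosZ scaler0.
Qed.

(** The commutator is skew, so it is multiplied by [i] to become symmetric.  It
    vanishes on the nongeneric part, and on the generic part it is a rotation
    by a right angle times [C S], which a vector [(v, j v)] with [j^2 = -1] and
    [C^2 v = t v] diagonalizes. *)
Lemma total_commutator :
  total_eigenvectors [set: L] (C \o C) ->
  diagonalizable_on [set: H] (commutator P Q).
Proof.
move=> C2_total.
pose D h := 'i%C *: commutator P Q h.
have i0 : ('i%C : R[i]) != 0 by rewrite -sqrf_eq0 sqr_i oppr_eq0 oner_eq0.
have D_sym : symmetric_on [set: H] D.
  move=> x y _ _; rewrite /D innerZl innerZr commutator_skew innerNr.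
  have -> : ('i%C : R[i])^* = - 'i%C.
    by apply/eqP; rewrite eq_complex /= oppr0 !eqxx.
  ring.
suff D_total : total_eigenvectors [set: H] D.
  have [//|B Bb Beig] := total_diagonalizable closed_subspaceT _ D_sym D_total.
  exists B => // e /Beig[a ae]; exists ('i%C^-1 * a).
  by rewrite -scalerA -ae /D scalerA mulVf // scale1r.
move=> h _ h_orth.
have h_ker v : commutator P Q v = 0 -> '<<h, v>> = 0.
  by move=> Dv; apply: (h_orth v 0) => //; rewrite /D Dv scaler0 scale0r.
have /generic_partP[x [y hE]] : G h.
  move=> _ [h11 [h00 [h10 [h01 [[P11 Q11] [P00 Q00] [P10 Q10] [P01 Q01] ->]]]]].
  have {}P11 := range_fix P_idem P11; have {}Q11 := range_fix Q_idem Q11.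
  have {}P10 := range_fix P_idem P10; have {}Q01 := range_fix Q_idem Q01.
  rewrite /nullspace /= in P00 Q00 Q10 P01.
  rewrite !innerDr !h_ker ?addr0 // /commutator.
  - by rewrite P01 Q01 P01 (symmetric0 Q_sym) subrr.
  - by rewrite P10 Q10 (symmetric0 P_sym) subrr.
  - by rewrite P00 Q00 (symmetric0 P_sym) (symmetric0 Q_sym) subrr.
  by rewrite P11 Q11 P11 subrr.
have xy0 v t : C (C v) = t *: v -> '<<x, v>> = 0 /\ '<<y, v>> = 0.
  move=> tv; have [->|v0] := eqVneq v 0; first by rewrite !inner0r.
  have [_ Cv] := positive_sqrt_eigenvector C_sym C_ge0 tv v0.
  have SSv : S (S v) = (1 - t) *: v.
    by rewrite scalerBl scale1r -tv -{2}(halmos_cos2_sin2 v) addrC addKr.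
  have [_ Sv] := positive_sqrt_eigenvector S_sym S_ge0 SSv v0.
  set c := sqrtC t in Cv; set s := sqrtC (1 - t) in Sv.
  have eig (j : R[i]) : j * j = -1 -> '<<h, W (v, j *: v)>> = 0.
    move=> jj; apply: (h_orth _ ('i%C * (j * c * s))) => //.
    rewrite /D halmos_commutator (symmetricZ _ _ S_sym) (symmetricZ _ _ C_sym).
    rewrite Cv Sv (symmetricZ _ _ C_sym) (symmetricZ _ _ S_sym) Cv Sv !scalerA.
    rewrite -[RHS]scalerA; congr (_ *: _); rewrite -halmosZ.
    congr (W (_, _)); first by congr (_ *: _); ring.
    rewrite scalerA -scaleNr; congr (_ *: _).
    rewrite -[- _]mulN1r -jj; ring.
  have jj : ('i%C : R[i]) * 'i%C = -1 by rewrite -expr2 sqr_i.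
  have := eig _ jj; have := eig (- 'i%C); rewrite mulrNN => /(_ jj).
  rewrite hE !halmos_inner !innerZr rmorphN mulNr.
  set p := '<<x, v>>; set q := _ * '<<y, v>> => e1 e2.
  have p2 : p *+ 2 = 0 by rewrite mulr2n -[RHS](addr0 0) -{1}e1 -e2; ring.
  have p0 : p = 0 by move/eqP: p2; rewrite mulrn_eq0 => /eqP.
  split=> //; move: e2; rewrite p0 add0r => /eqP; rewrite mulf_eq0.
  by rewrite conjC_eq0 (negbTE i0) => /eqP.
rewrite hE; have -> : x = 0.
  by apply: C2_total => // v t _ /xy0[].
have -> : y = 0 by apply: C2_total => // v t _ /xy0[].
exact: linear0.
Qed.

(** On the generic part the square of the commutator is
    [- (C^2 - C^4)], and an eigenvector of the quadratic polynomial
    [C^2 - C^4] is a sum of at most two eigenvectors of [C^2]. *)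
Lemma commutator_total :
  total_eigenvectors [set: H] (commutator P Q) ->
  total_eigenvectors [set: L] X.
Proof.
move=> D_total a _ a_orth.
have a_cos2 e t : C (C e) = t *: e -> '<<a, e>> = 0.
  have [->|e0] := eqVneq e 0; first by rewrite inner0r.
  move=> te; have [_ Ce] := positive_sqrt_eigenvector C_sym C_ge0 te e0.
  by have [x xe] := eigenvector_of_cos Ce; exact: a_orth xe.
suff /halmos_inj[] : W (a, 0) = W (0, 0) by [].
rewrite [RHS]linear0; apply: D_total => // v d _ vd.
have [x [y [_ -> DW]]] := generic_component v; rewrite inner0l addr0.
have := DW _ (fun h => - commutator P Q h) d commutator_skew commutatorB _ vd.
rewrite halmos_commutator => /(_ _)/halmos_inj[].
  move=> h Gh; have GD : G (commutator P Q h).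
    apply: (closed_subspaceB generic_part_closed);
    by do ?[apply: generic_part_P | apply: generic_part_Q].
  split=> //; rewrite -scaleN1r.
  exact: (closed_subspaceZ generic_part_closed).
move=> CSy SCx.
have CCx : C (C x) - C (C (C (C x))) = (- (d * d)) *: x.
  rewrite -cos_sin2_cos -[S (S _)]opprK -scaleN1r.
  rewrite scaleN1r -[- S (S _)]scaleN1r.
  rewrite -(symmetricZ _ _ S_sym) scaleN1r SCx (symmetricZ _ _ S_sym).
  by rewrite -scaleNr (symmetricZ _ _ C_sym) CSy scalerA mulNr.
(* Complete the square in [C^2 - C^4]: [B^2 x = r^2 x] with a complex [r]. *)
pose B z := C (C z) - 2^-1 *: z.
have B_sym : symmetric B.
  move=> z w _ _; rewrite /B innerBl innerBr !C_sym // innerZl innerZr.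
  by rewrite fmorphV rmorph_nat.
pose r := sqrtC (4^-1 + d * d); have rr : r * r = 4^-1 + d * d.
  by rewrite -expr2 sqrtCK.
have BB : B (B x) = (r * r) *: x.
  rewrite {1}/B [in C (C _)]/B !(symmetricB _ _ C_sym, symmetricZ _ _ C_sym).
  rewrite /B scalerBr scalerA rr.
  have -> : C (C (C (C x))) = C (C x) + (d * d) *: x.
    by rewrite -[d * d]opprK scaleNr -CCx opprB addrC subrK.
  by apply: inner_ext => z; rewrite !(innerDl, innerNl, innerZl); field.
have B_orth z t : B z = t *: z -> '<<a, z>> = 0.
  move=> Bz; apply: (a_cos2 z (t + 2^-1)).
  by rewrite scalerDl -Bz subrK.
have [r0|r0] := eqVneq r 0.
  have Bx : B x = 0.
    by apply: inner_eq0; rewrite B_sym // BB r0 mul0r scale0r inner0r.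
  by apply: (B_orth _ 0); rewrite scale0r.
have -> : x = (2 * r)^-1 *: ((B x + r *: x) - (B x - r *: x)).
  by apply: inner_ext => z; rewrite !(innerDl, innerNl, innerZl); field.
rewrite innerZr innerBr (B_orth _ r) ?(B_orth _ (- r)) ?subrr ?mulr0 //.
  rewrite (symmetricB _ _ B_sym) (symmetricZ _ _ B_sym) BB.
  by apply: inner_ext => z; rewrite !(innerDl, innerNl, innerZl); ring.
rewrite (symmetricD _ _ B_sym) (symmetricZ _ _ B_sym) BB.
by apply: inner_ext => z; rewrite !(innerDl, innerNl, innerZl); ring.
Qed.

End TwoProjections.

(** * Orthonormal families and Fourier series *)

Lemma countable_enumeration {T : pointedType} (A : set T) : countable A ->
  exists (N : option nat) (f : nat -> T),
    set_bij [set n | in_range N n] A f.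
Proof.
move=> Ac; have [[n An]|A_inf] := pselect (finite_set A).
  have /pcard_eqP[f] : (`I_n #= A)%card by rewrite card_eq_sym.
  by exists (Some n), f; exact: 'bij_f.
have /pcard_eqP[f] : ([set: nat] #= A)%card.
  apply: Cantor_Bernstein; last exact: Ac.
  exact: (proj1 (infiniteP _) A_inf).
exists None, f; have -> : [set n | in_range None n] = [set: nat] by apply/seteqP.
exact: 'bij_f.
Qed.

Section OrthonormalFamilies.
Context {R : realType} {H : hilbertType R}.
Implicit Types (M B : set H) (x y z : H).

Lemma separable_approx : separable_space H ->
  exists2 D : set H, countable D &
    forall x (e : R), 0 < e -> exists2 d, D d & nr (x - d) < e.
Proof.
move=> [D Dc Ddense]; exists D => // x e e0.
have [||d [/interior_subset]] := Ddense (ball x e%:C)°.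
- by exists x; apply: nbhsx_ballx; rewrite ltcR.
- exact: open_interior.
by rewrite -ball_normE /= nrE ltcR => xd Dd; exists d.
Qed.

(** Orthonormal vectors are at distance [sqrt 2] from each other, so points of
    a countable dense set within distance [1 / 2] of them are distinct. *)
Lemma orthonormal_countable B : separable_space H ->
  orthonormal_system B id -> countable B.
Proof.
move=> /separable_approx[D Dc Dapprox] Bon.
have half0 : 0 < 2^-1 :> R by rewrite invr_gt0.
have near x : exists y, D y /\ nr (x - y) < 2^-1.
  by have [y Dy xy] := Dapprox x _ half0; exists y.
have [d dP] := choice near.
apply: (sub_countable _ Dc).
have d_inj : {in B &, injective d}.
  move=> x y /set_mem Bx /set_mem By dxy.
  have [//|xy] := eqVneq x y.
  have xy1 : nr (x - y) < 1.
    apply: (le_lt_trans (ler_nr_add _ (d x) _)); rewrite [ltRHS]splitr mul1r.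
    by apply: ltrD; [case: (dP x)|rewrite dxy nr_dist; case: (dP y)].
  have : nr (x - y) ^+ 2 < 1 by rewrite expr_lt1 ?nr_ge0.
  have -> : nr (x - y) ^+ 2 = 2.
    apply: complexI; rewrite -inner_nr innerBl !innerBr (Bon x x) // (Bon y y) //.
    rewrite (Bon x y) // (Bon y x) // [y == x]eq_sym (negbTE xy) !eqxx.
    by rewrite rmorph_nat /=; ring.
  by rewrite ltNge ler1n.
rewrite -(card_le_eql (inj_card_eq d_inj)); apply: subset_card_le.
by move=> _ [x _ <-]; case: (dP x).
Qed.

Section Fourier.
Context {N : option nat} {f : nat -> H}.
Hypothesis f_on : orthonormal_system [set n | in_range N n] f.

Lemma inner_orthonormal_sum (c : nat -> R[i]) n m : in_range N n ->
  '<<\sum_(0 <= k < m | in_range N k) c k *: f k, f n>> =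
  if (n < m)%N then c n else 0.
Proof.
move=> Nn; rewrite inner_suml.
have coef k : in_range N k -> '<<c k *: f k, f n>> = if k == n then c n else 0.
  move=> Nk; rewrite innerZl f_on //.
  by case: eqP => [->|_]; rewrite ?mulr1 ?mulr0.
by rewrite (eq_bigr _ coef) -big_mkcondr big_nat1_cond_eq Nn andbT.
Qed.

Let S x m := \sum_(0 <= k < m | in_range N k) '<<x, f k>> *: f k.

Let SB x y m : S (x - y) m = S x m - S y m.
Proof.
rewrite /S -sumrB; apply: eq_bigr => k _.
by rewrite innerBl scalerBl.
Qed.

(** Bessel's inequality: the partial sum and the remainder are orthogonal. *)
Let nr_S_le x m : nr (S x m) <= nr x.
Proof.
have orth : '<<S x m, x - S x m>> = 0.
  rewrite {1}/S inner_suml big_nat_cond big1 // => k /andP[/andP[_ km] Nk].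
  rewrite innerZl; apply/eqP; rewrite mulf_eq0; apply/orP; right; apply/eqP.
  by apply: inner_eq0C; rewrite innerBl inner_orthonormal_sum // km subrr.
by have := nr_orth_le orth; rewrite addrC subrK.
Qed.

(** Closed because the partial sums are bounded uniformly in their length. *)
Lemma fourier_closed_subspace : closed_subspace [set x | S x @ \oo --> x].
Proof.
apply/closed_subspaceP; split.
- apply/cvg_nrP => e e0; exists 0%N => m _.
  by rewrite /S big1 ?subr0 ?nr0 ?(ltW e0) // => k _; rewrite inner0l scale0r.
- move=> a x y /= Sx Sy.
  rewrite [X in X @ _ --> _](_ : _ = fun m => a *: S x m + S y m).
    by apply: cvgD => //; exact: cvgZr.
  apply/funext => m; rewrite /S scaler_sumr -big_split /=.
  by apply: eq_bigr => k _; rewrite innerDl innerZl scalerDl scalerA.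
move=> x /closureP clx; apply/cvg_nrP => e e0.
have e3 : 0 < e / 3 by rewrite divr_gt0.
have [y /cvg_nrP/(_ _ e3)[m mP] xy] := clx _ e3; exists m => n /mP yn.
have -> : x - S x n = (x - y) + ((y - S y n) - S (x - y) n).
  by rewrite SB opprB !subrKA.
apply: (le_trans (ler_nrD _ _)).
have := ler_nrD (y - S y n) (- S (x - y) n); rewrite nrN.
have := nr_S_le (x - y) n; lra.
Qed.

(** Project [y] onto the subspace of the vectors that equal their Fourier
    series; the remainder is orthogonal to the [f n] and, like [y], to the
    other vectors of the basis. *)
Lemma fourier_expansion M B y :
  closed_subspace M -> orthonormal_basis M B ->
  (forall n, in_range N n -> B (f n)) -> M y ->
  (forall e, B e -> (forall n, in_range N n -> f n <> e) -> '<<y, e>> = 0) ->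
  S y @ \oo --> y.
Proof.
move=> Mc Bb Bf My y_orth; have [BM Bon _] := Bb.
have [k Yk yk] := orthogonal_decomposition fourier_closed_subspace y.
have Mk : M k.
  apply: closed_subspace_cvg (Mc) _ _ _ (Yk) => m.
  apply: (big_ind M) => [|u v|i Ni].
  - exact: (closed_subspace0 Mc).
  - exact: (closed_subspaceD Mc).
  by apply: (closed_subspaceZ Mc); apply: BM; exact: Bf.
suff /eqP : y - k = 0 by rewrite subr_eq0 => /eqP ->.
apply: orthonormal_basis_total (Bb) _ _; first exact: closed_subspaceB.
move=> e Be; have [[n [Nn ne]]|e_new] :=
    pselect (exists n, in_range N n /\ f n = e).
  rewrite -ne; apply: yk => /=; apply/cvg_nrP => e' e'0; exists n.+1 => m nm.
  have -> : S (f n) m = f n; last by rewrite subrr nr0 ltW.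
  have coef k' : in_range N k' ->
      '<<f n, f k'>> *: f k' = if k' == n then f n else 0.
    by move=> Nk'; rewrite f_on // eq_sym; case: eqP => [->|_];
      rewrite ?scale1r ?scale0r.
  by rewrite /S (eq_bigr _ coef) -big_mkcondr big_nat1_cond_eq Nn nm.
have ef n : in_range N n -> '<<f n, e>> = 0.
  move=> Nn; rewrite (Bon _ _ (Bf _ Nn) Be); case: eqP => // ne.
  by case: e_new; exists n.
rewrite innerBl y_orth // ?sub0r; last first.
  by move=> n Nn ne; case: e_new; exists n.
apply/eqP; rewrite oppr_eq0; apply/eqP; apply: cvg_inner_const (Yk) _.
exists 0%N => m _; rewrite inner_suml big1 // => i Ni.
by rewrite innerZl ef // mulr0.
Qed.

End Fourier.
End OrthonormalFamilies.

(** * Schmidt decompositions *)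

Section Schmidt.
Context {R : realType} {H : hilbertType R}.
Variables (M : set H) (T T' : {linear H -> H}).
Hypotheses (M_closed : closed_subspace M).
Hypotheses (MT : forall x, M x -> M (T x)) (MT' : forall x, M x -> M (T' x)).
Hypothesis T_adj : forall x y, M x -> M y -> '<<T x, y>> = '<<x, T' y>>.

Lemma inner_ext_on x y : M x -> M y ->
  (forall z, M z -> '<<z, x>> = '<<z, y>>) -> x = y.
Proof.
move=> Mx My xy; apply/eqP; rewrite -subr_eq0; apply/eqP/inner_eq0.
by rewrite innerBr xy ?subrr //; exact: closed_subspaceB.
Qed.

Section Decomposition.
Variables (N : option nat) (f g : nat -> H) (s : nat -> R).
Hypothesis fgs : forall n, in_range N n -> [/\ M (f n), M (g n) & 0 < s n].
Hypothesis f_on : orthonormal_system [set n | in_range N n] f.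
Hypothesis g_on : orthonormal_system [set n | in_range N n] g.
Hypothesis T_sum : forall h, M h ->
  (fun m => \sum_(0 <= n < m | in_range N n)
              (s n)%:C *: rank_one (f n) (g n) h) @ \oo --> T h.

(** [T'] maps [f n] to [s n g n] and [T] maps [g n] back to [s n f n]. *)
Lemma schmidt_eigenvector n : in_range N n ->
  T (T' (f n)) = ((s n)%:C * (s n)%:C) *: f n.
Proof.
move=> Nn; have [Mf Mg sn] := fgs Nn.
have T'f : T' (f n) = (s n)%:C *: g n.
  apply: inner_ext_on => [||z Mz]; [exact: MT' | exact: closed_subspaceZ |].
  rewrite -T_adj // innerZr realC_conj.
  apply: cvg_inner_const (T_sum Mz) _; exists n.+1 => m nm.
  under eq_bigr do rewrite /rank_one scalerA.
  by rewrite inner_orthonormal_sum // nm.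
have Tg : T (g n) = (s n)%:C *: f n.
  apply: inner_ext => z; apply: cvg_inner_const (T_sum Mg) _; exists n.+1 => m nm.
  have coef k : in_range N k ->
      (s k)%:C *: rank_one (f k) (g k) (g n) =
      if k == n then (s n)%:C *: f n else 0.
    move=> Nk; rewrite /rank_one g_on // eq_sym.
    by case: eqP => [->|_]; rewrite ?scale1r // scale0r scaler0.
  by rewrite (eq_bigr _ coef) -big_mkcondr big_nat1_cond_eq Nn nm.
by rewrite T'f linearZ /= Tg scalerA.
Qed.

Lemma schmidt_range_orth w h : M h ->
  (forall n, in_range N n -> '<<f n, w>> = 0) -> '<<T h, w>> = 0.
Proof.
move=> Mh fw; apply: cvg_inner_const (T_sum Mh) _; exists 0%N => m _.
rewrite inner_suml big1 // => k Nk.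
by rewrite !innerZl fw // !mulr0.
Qed.

End Decomposition.

(** The left singular vectors are the eigenvectors [f] of [T T'] with a nonzero
    eigenvalue, the singular values are [|T' f|], and the right singular
    vectors are the normalised [T' f]; the sum is the Fourier series of [T h]
    in the eigenbasis. *)
Lemma diagonalizable_schmidt : separable_space H ->
  diagonalizable_on M (T \o T') -> schmidt_decomposable_on M T.
Proof.
move=> Hsep [B Bb Beig]; have [BM Bon _] := Bb.
pose B' := B `&` [set e | T' e <> 0].
have B'c : countable B'.
  apply: orthonormal_countable Hsep _ => e e' [Be _] [Be' _]; exact: Bon.
have [N [f [f_hom f_inj f_surj]]] := countable_enumeration B'c.
have fB n : in_range N n -> B (f n) by move=> /f_hom[].
have fM n : in_range N n -> M (f n) by move=> /fB /BM.
have f_on : orthonormal_system [set n | in_range N n] f.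
  move=> i j Ni Nj; rewrite (Bon _ _ (fB _ Ni) (fB _ Nj)).
  have [->|ij] := eqVneq i j; first by rewrite eqxx.
  by case: eqP => // fij; case/eqP: ij; apply: f_inj => //; rewrite inE.
pose s n := nr (T' (f n)).
have s_gt0 n : in_range N n -> 0 < s n.
  move=> /f_hom[_ /= T'f]; rewrite lt_neqAle nr_ge0 andbT eq_sym.
  by apply/eqP => /nr_eq0.
pose g n := (s n)^-1%:C *: T' (f n).
have sg n : in_range N n -> (s n)%:C *: g n = T' (f n).
  by move=> /s_gt0 sn; rewrite /g scalerA -rmorphM mulfV ?gt_eqF // scale1r.
have gM n : in_range N n -> M (g n).
  by move=> Nn; apply: closed_subspaceZ => //; apply: MT'; exact: fM.
exists N, f, g, s; split=> //.
- by move=> n Nn; split; [exact: fM | exact: gM | exact: s_gt0].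
- move=> i j Ni Nj; rewrite /g innerZl innerZr realC_conj.
  have TT' : '<<T' (f i), T' (f j)>> = '<<T (T' (f i)), f j>>.
    by rewrite T_adj //; [apply: MT'; exact: fM | exact: fM].
  have [ij|ij] := eqVneq i j.
    rewrite -ij inner_nr mulrA -!rmorphM.
    by rewrite expr2 -/(s i) mulrA mulfVK ?mulVf ?gt_eqF ?s_gt0.
  have [a ae] := Beig _ (fB _ Ni).
  rewrite TT'; move: ae => /= ->.
  by rewrite innerZl f_on // (negbTE ij) !mulr0.
move=> h Mh.
have coef n : in_range N n ->
    (s n)%:C *: rank_one (f n) (g n) h = '<<T h, f n>> *: f n.
  move=> Nn; rewrite /rank_one scalerA T_adj //; last exact: fM.
  by rewrite -(sg _ Nn) innerZr realC_conj.
have -> : (fun m => \sum_(0 <= n < m | in_range N n)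
    (s n)%:C *: rank_one (f n) (g n) h) =
    (fun m => \sum_(0 <= n < m | in_range N n) '<<T h, f n>> *: f n).
  by apply/funext => m; apply: eq_bigr.
apply: (fourier_expansion f_on M_closed Bb fB (MT Mh)) => e Be e_new.
have T'e : T' e = 0.
  apply: contrapT => T'e; have [|n Nn ne] := f_surj e; first by split.
  exact: e_new n Nn ne.
by rewrite T_adj ?T'e ?inner0r //; exact: BM.
Qed.

End Schmidt.

(** * The equivalence *)

Section OrthogonalProjection.
Context {R : realType} {H : hilbertType R} {M : set H} {P : H -> H}.
Hypotheses (M_closed : closed_subspace M) (P_proj : orthogonal_projection M P).

Lemma orthogonal_projection_id x : M x -> P x = x.
Proof.
move=> Mx; have [MPx Px_orth] := P_proj x.
apply/eqP; rewrite eq_sym -subr_eq0; apply/eqP/inner_eq0/Px_orth.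
exact: closed_subspaceB.
Qed.

Lemma orthogonal_projection_idem x : P (P x) = P x.
Proof. by apply: orthogonal_projection_id; have [] := P_proj x. Qed.

Lemma orthogonal_projectionE : M = [set x | P x = x].
Proof.
apply/seteqP; split=> x /=; first exact: orthogonal_projection_id.
by move=> <-; have [] := P_proj x.
Qed.

Lemma orthogonal_projection_symmetric : symmetric P.
Proof.
move=> x y _ _; have [[MPx x_orth] [MPy y_orth]] := (P_proj x, P_proj y).
rewrite -{1}[y](subrK (P y)) -{2}[x](subrK (P x)) innerDr innerDl.
by rewrite (inner_eq0C (y_orth _ MPx)) (x_orth _ MPy).
Qed.

End OrthogonalProjection.

Unset Implicit Arguments.

Theorem corollary4p2 (R : realType) (H : hilbertType R)
    (H_separable : separable_space H)
    (L0 : set H) (L0_closed : closed_subspace L0)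
    (P0 : {linear H -> H}) (P0_proj : orthogonal_projection L0 P0)
    (U Ustar : {linear H -> H}) (U_unitary : unitary_with_adjoint U Ustar)
    (L : hilbertType R) (W : {linear (L * L)%type -> H}) (X : {linear L -> L})
    (X_halmos : halmos_decomposition P0 (U \o P0 \o Ustar) W X) :
  [<-> schmidt_decomposable_on L0 (P0 \o U);
       diagonalizable_on setT (commutator P0 (U \o P0 \o Ustar));
       diagonalizable_on setT X].
Proof.
have [U_adj UsU UUs] := U_unitary.
have P_sym := orthogonal_projection_symmetric P0_proj.
have P_idem := orthogonal_projection_idem L0_closed P0_proj.
have LE := orthogonal_projectionE L0_closed P0_proj.
have Us_adj x y : '<<Ustar x, y>> = '<<x, U y>>.
  by rewrite [LHS]innerC -U_adj -innerC.
set Q := U \o P0 \o Ustar in X_halmos *.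
have Q_sym : symmetric Q.
  by move=> x y _ _; rewrite /Q /= U_adj P_sym // Us_adj.
have Q_idem x : Q (Q x) = Q x by rewrite /Q /= UsU P_idem.
pose T : {linear H -> H} := P0 \o U.
pose T' : {linear H -> H} := P0 \o Ustar.
have LT x : L0 x -> L0 (T x) by move=> _; case: (P0_proj (U x)).
have LT' x : L0 x -> L0 (T' x) by move=> _; case: (P0_proj (Ustar x)).
have T_adj x y : L0 x -> L0 y -> '<<T x, y>> = '<<x, T' y>>.
  move=> Lx Ly; rewrite /T /T' /= P_sym // U_adj.
  rewrite (orthogonal_projection_id L0_closed P0_proj Ly) -P_sym //.
  by rewrite (orthogonal_projection_id L0_closed P0_proj Lx).
have TT'E : T \o T' = P0 \o Q by [].
tfae.
- move=> [N [f [g [s [fgs f_on g_on T_sum]]]]].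
  apply: (total_commutator P_sym P_idem Q_sym Q_idem X_halmos) => a _ a_orth.
  pose w := W (a, 0).
  have Pw : P0 w = w by exact: halmos_P X_halmos a 0.
  have Lw : L0 w by rewrite -Pw; case: (P0_proj w).
  have fw n : in_range N n -> '<<f n, w>> = 0.
    move=> Nn; have [Lf _ _] := fgs _ Nn; apply: inner_eq0C.
    have PQf := schmidt_eigenvector L0_closed LT' T_adj fgs f_on g_on T_sum Nn.
    apply: (range_compression_eigenvector P_sym Q_sym X_halmos _ PQf).
      exact: orthogonal_projection_id L0_closed P0_proj _ Lf.
    by move=> e c ce; exact: a_orth ce.
  apply: (range_compression_definite Q_sym X_halmos).
  exact: (schmidt_range_orth T_sum (LT' _ Lw) fw).
- move=> /diagonalizable_total D_total.
  apply: total_diagonalizable => //; first exact: closed_subspaceT.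
    by move=> x y _ _; exact: halmos_selfadjoint X_halmos x y.
  exact: (commutator_total P_sym Q_sym Q_idem X_halmos D_total).
move=> /diagonalizable_total X_total.
apply: (diagonalizable_schmidt L0_closed LT LT' T_adj H_separable).
apply: (total_diagonalizable L0_closed) => [x Lx|x y Lx Ly|].
- by apply: LT; exact: LT'.
- have [Px Py] : P0 x = x /\ P0 y = y.
    by split; exact: orthogonal_projection_id L0_closed P0_proj _ _.
  by rewrite TT'E /= P_sym // Py -[RHS]P_sym // Px Q_sym.
have := total_range_compression P_sym P_idem Q_sym Q_idem X_halmos X_total.
by rewrite -LE TT'E.
Qed.
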